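(* Let $A\in\mathbb{Q}^{n\times n}$ be expanding with $b\geqslant2$. The characters of $\mathbb{K}_A$ are exactly the maps of the form $$\chi_{r,s}:\mathbb{K}_A\to\mathbb{S}^1,\qquad \chi_{r,s}(x,y)=\exp(2\pi i\langle x,r\rangle)\exp(2\pi i S_s(y)),$$ for $r\in\mathbb{R}^n$ and $s\in\mathbb{Z}^n((B^* ))$. Moreover, the map $(r,s)\mapsto\chi_{r,s}$ is a group isomorphism from $\mathbb{R}^n\times\mathbb{Z}^n((B^* ))$ onto the group $\widehat{\mathbb{K}_A}$ of characters of $\mathbb{K}_A$.
   Context: Let $n\geqslant 1$, let $A\in\mathbb{Q}^{n\times n}$ be expanding (all eigenvalues have absolute value $>1$), $B:=A^{-1}$, and let $A^*,B^*$ be the transposes of $A,B$. For an invertible $M\in\mathbb{Q}^{n\times n}$ and a full rank lattice $L\subset\mathbb{R}^n$ let $L[M]:=\bigcup_{k\geqslant 1}(L+ML+\dots+M^{k-1}L)$ and $L(M):=\bigcup_{k\geqslant 1}(M^{-k}L+M^{-k+1}L+\dots+M^{k}L)$. Put $b:=|\mathbb{Z}^n[B]/B\mathbb{Z}^n[B]|$ (finite). For $y\in\mathbb{Z}^n(B)$ let $\nu(y):=\inf\{k\in\mathbb{Z} : y\notin B^{k+1}\mathbb{Z}^n[B]\}\in\mathbb{Z}\cup\{\infty\}$ (with $\inf\varnothing=\infty$), and ${\bf d}_B(y,y'):=b^{-\nu(y-y')}$, with $b^{-\infty}=0$. $\mathbb{Z}^n((B))$ is the completion of $\mathbb{Z}^n(B)$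 with respect to ${\bf d}_B$ (points at distance $0$ being identified); the group structure, $\nu$, ${\bf d}_B$ and multiplication by powers of $B$ extend to it. $\mathbb{K}_A:=\mathbb{R}^n\times\mathbb{Z}^n((B))$, a locally compact abelian group with metric $\max\{\|x-x'\|,{\bf d}_B(y,y')\}$. Let $\Lambda,\Gamma$ be fixed full rank lattices in $\mathbb{R}^n$ with $\mathbb{Z}^n[A]\cap\mathbb{Z}^n[B]\subset\Lambda$ and $\Gamma[A^*]\cap\Gamma[B^*]\subset\Lambda^*\subset\mathbb{Z}^n$, where $\Lambda^*:=\{x\in\mathbb{Z}^n:\langle x,z\rangle\in\mathbb{Z}\text{ for all }z\in\Lambda\}$ and $\langle\cdot,\cdot\rangle$ is the usual scalar product. The space $\mathbb{Z}^n((B^* ))$ is defined analogously to $\mathbb{Z}^n((B))$: it is the completion of $\Gamma(B^* )$ with respect to $b^{-\nu^*(s-s')}$, where $\nu^*(s):=\inf\{k\in\mathbb{Z}:s\notin B^{*\,k+1}\Gamma[B^*]\}$ (again identifying points at distance $0$). Let $\mathcal{E}\subset\mathbb{Z}^n$ be a complete set of representatives of $\mathbb{Z}^n[B]/B\mathbb{Z}^n[B]$ with $0\in\mathcal{E}$, and $\mathcal{E}^*\subset\Gamma$ a complete set of representatives of $\Gamma[B^*]/B^*\Gamma[B^*]$ with $0\in\mathcal{E}^*$. Every $y\in\mathbb{Z}^n((B))$ has a unique expansion $y=\sum_{j=\nu(y)}^\infty B^jy_j$ with $y_j\in\mathcal{E}$, and every $s\in\mathbb{Z}^n((B^* ))$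 a unique expansion $s=\sum_{j=\nu^*(s)}^\infty B^{*j}s_j$ with $s_j\in\mathcal{E}^*$ (the empty sum for the zero element). The $B$-adic fractional part of $y$ is the vector $\{y\}_B:=\sum_{j=\nu(y)}^{-1}B^jy_j\in\mathbb{Q}^n$ (equal to $0$ if $\nu(y)\geqslant0$). For $s\in\mathbb{Z}^n((B^* ))$ and $y\in\mathbb{Z}^n((B))$ define $S_s(y):=\sum_{j=\nu^*(s)}^\infty\langle\{B^jy\}_B,s_j\rangle$ (only finitely many terms are nonzero). A character of a locally compact abelian group $G$ is a continuous homomorphism $G\to\mathbb{S}^1$. *)

(* Defs.v *)
From HB Require Import structures.
From mathcomp Require Import all_boot all_order all_algebra.
From mathcomp Require Import finmap complex.
From mathcomp Require Import zify lra.
From mathcomp Require Import all_classical all_reals all_analysis.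

Set Implicit Arguments.
Unset Strict Implicit.
Unset Printing Implicit Defensive.

Import Order.TTheory GRing.Theory Num.Theory.
Import numFieldNormedType.Exports.

Local Open Scope classical_set_scope.
Local Open Scope ring_scope.

(* R^n is 'cV[R]_n.+1, so that the dimension is >= 1. *)

Definition expanding (R : realType) (n : nat) (A : 'M[rat]_n.+1) : Prop :=
  forall l : R[i], eigenvalue (map_mx ratr A) l -> 1 < `|l|.

Section Lattices.
Context {R : realType} {n : nat}.
Local Notation V := ('cV[R]_n.+1).
Implicit Types (L : set V) (M : 'M[rat]_n.+1) (x y z : V).

Definition full_lattice L : Prop :=
  exists2 P : 'M[R]_n.+1, P \is a GRing.unit &
    L = [set P *m map_mx intr z | z in [set: 'cV[int]_n.+1]].

Record lattice := Lattice {
  lattice_set :> set V;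
  lattice_full : full_lattice lattice_set }.

Definition int_vectors : set V :=
  [set map_mx intr z | z in [set: 'cV[int]_n.+1]].

Lemma int_vectors_full : full_lattice int_vectors.
Proof.
exists 1%R; first exact: unitr1.
by apply: eq_imagel => z _; rewrite mul1mx.
Qed.

Definition Zlattice : lattice := Lattice int_vectors_full.

Definition ratmul M x : V := map_mx ratr M *m x.

(* L[M] and L(M) *)
Definition lbracket L M : set V :=
  \bigcup_(k in [set k : nat | (1 <= k)%N])
    [set \sum_(i < k) ratmul (M ^+ i) (l i) |
       l in [set l : 'I_k -> V | forall i, L (l i)]].

Definition lparen L M : set V :=
  \bigcup_(k in [set k : nat | (1 <= k)%N])
    [set \sum_(i < k.*2.+1) ratmul (M ^ (i%:Z - k%:Z)) (l i) |
       l in [set l : 'I_k.*2.+1 -> V | forall i, L (l i)]].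

(* M^k L[M] *)
Definition adic_ball L M (k : int) : set V :=
  [set ratmul (M ^ k) x | x in lbracket L M].

Definition adic_quotient L M : set (set V) :=
  [set [set x + y | y in adic_ball L M 1] | x in lbracket L M].

(* |L[M] / M L[M]|, with value 0 if this quotient is infinite *)
Definition adic_index L M : nat := #|` fset_set (adic_quotient L M)|%N.

Definition nu L M x : \bar R :=
  ereal_inf [set ((k%:~R : R)%:E) | k in
               [set k : int | ~ adic_ball L M (k + 1) x]].

(* b^{-v}; the value at -oo is irrelevant, nu being > -oo on L(M) *)
Definition adic_abs (b : nat) (v : \bar R) : R :=
  if v is r%:E then b%:R `^ (- r) else 0.

Definition adic_dist L M (b : nat) x y : R := adic_abs b (nu L M (x - y)).

Definition residue_system L M (E : set V) : Prop :=
  [/\ E `<=` L, E 0 & forall x, lbracket L M x ->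
     exists! e, E e /\ adic_ball L M 1 (x - e)].

Definition dotp x y : R := \sum_i x i ord0 * y i ord0.

Definition dual_lattice L : set V :=
  [set x | int_vectors x /\ forall z, L z -> exists m : int, dotp x z = m%:~R].

End Lattices.

Arguments lattice : clear implicits.
Arguments Zlattice : clear implicits.

(* A lattice L, an invertible matrix M and a base b > 1, from which the
   completion of L(M) for the distance b^{-nu} is built. *)
Record adic_system (R : realType) (n : nat) := AdicSystem {
  adic_lat : lattice R n;
  adic_mat : 'M[rat]_n.+1;
  adic_base : nat;
  adic_mat_unit : adic_mat \is a GRing.unit;
  adic_base_gt1 : (1 < adic_base)%N }.

Section Completion.
Context {R : realType} {n : nat}.
Local Notation V := ('cV[R]_n.+1).
Variable D : adic_system R n.
Local Notation L := (adic_lat D : set V).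
Local Notation M := (adic_mat D).
Local Notation b := (adic_base D).
Implicit Types (x y z : V) (k j : int).

Local Notation N x := (adic_abs b (nu L M x) : R).

Let Mu : M \is a GRing.unit. Proof. exact: adic_mat_unit. Qed.

Lemma ratmulD (K : 'M[rat]_n.+1) : {morph @ratmul R n K : x y / x + y}.
Proof. by move=> x y; rewrite /ratmul mulmxDr. Qed.

Lemma ratmulN (K : 'M[rat]_n.+1) : {morph @ratmul R n K : x / - x}.
Proof. by move=> x; rewrite /ratmul mulmxN. Qed.

Lemma ratmulB (K : 'M[rat]_n.+1) : {morph @ratmul R n K : x y / x - y}.
Proof. by move=> x y; rewrite ratmulD ratmulN. Qed.

Lemma ratmul0 (K : 'M[rat]_n.+1) : @ratmul R n K 0 = 0.
Proof. by rewrite /ratmul mulmx0. Qed.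

Lemma ratmul_sum (K : 'M[rat]_n.+1) I (r : seq I) (P : pred I) (F : I -> V) :
  ratmul K (\sum_(i <- r | P i) F i) = \sum_(i <- r | P i) ratmul K (F i).
Proof. by rewrite /ratmul mulmx_sumr. Qed.

Lemma ratmulM (K K' : 'M[rat]_n.+1) x :
  ratmul K (ratmul K' x) = ratmul (K * K') x.
Proof. by rewrite /ratmul mulmxA -map_mxM. Qed.

Lemma ratmulXzD k j x :
  ratmul (M ^ k) (ratmul (M ^ j) x) = ratmul (M ^ (k + j)) x.
Proof. by rewrite ratmulM -exprzDr. Qed.

Lemma lattice0 : L 0.
Proof.
case: (lattice_full (adic_lat D)) => P _ ->; exists 0 => //.
by rewrite map_mx0 mulmx0.
Qed.

Lemma latticeB x y : L x -> L y -> L (x - y).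
Proof.
case: (lattice_full (adic_lat D)) => P _ -> [u _ <-] [v _ <-].
by exists (u - v) => //; rewrite map_mxB mulmxBr.
Qed.

Lemma lbracketP x : lbracket L M x <->
  exists (m : nat) (l : nat -> V),
    (forall i, L (l i)) /\ x = \sum_(i < m) ratmul (M ^+ i) (l i).
Proof.
split=> [[m _ [l Ll <-]]|[m [l [Ll ->]]]].
  exists m, (fun i => if insub i is Some j then l j else 0); split.
    by move=> i; case: insubP => // _; exact: lattice0.
  by apply: eq_bigr => i _; rewrite valK.
exists m.+1 => //.
exists (fun i : 'I_m.+1 => if (i < m)%N then l i else 0).
  by move=> i /=; case: ifP => // _; exact: lattice0.
rewrite big_ord_recr /= ltnn ratmul0 addr0.
by apply: eq_bigr => i _; rewrite ltn_ord.
Qed.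

Lemma lbracket_pad m p (l : nat -> V) : (m <= p)%N ->
  \sum_(i < m) ratmul (M ^+ i) (l i) =
  \sum_(i < p) ratmul (M ^+ i) (if (i < m)%N then l i else 0).
Proof.
move=> mp; rewrite (big_ord_widen p (fun i => ratmul (M ^+ i) (l i)) mp).
rewrite big_mkcond /=; apply: eq_bigr => i _.
by case: ifP => // _; rewrite ratmul0.
Qed.

Lemma lbracket0 : lbracket L M 0.
Proof.
apply/lbracketP; exists 0%N, (fun=> 0); split; last by rewrite big_ord0.
by move=> _; exact: lattice0.
Qed.

Lemma lbracketB x y : lbracket L M x -> lbracket L M y -> lbracket L M (x - y).
Proof.
move=> /lbracketP[m [l [Ll ->]]] /lbracketP[p [l' [Ll' ->]]].
apply/lbracketP; exists (maxn m p), (fun i =>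
  (if (i < m)%N then l i else 0) - (if (i < p)%N then l' i else 0)); split.
  by move=> i; apply: latticeB; case: ifP => // _; exact: lattice0.
rewrite (lbracket_pad l (leq_maxl m p)) (lbracket_pad l' (leq_maxr m p)).
by rewrite -sumrB; apply: eq_bigr => i _; rewrite ratmulB.
Qed.

Lemma lbracket_mul x : lbracket L M x -> lbracket L M (ratmul M x).
Proof.
move=> /lbracketP[m [l [Ll ->]]]; apply/lbracketP.
exists m.+1, (fun i => if i is j.+1 then l j else 0); split.
  by case=> [|i]; [exact: lattice0|exact: Ll].
rewrite big_ord_recl /= ratmul0 add0r ratmul_sum.
by apply: eq_bigr => i _; rewrite ratmulM -exprS.
Qed.

Lemma adic_ball0 k : adic_ball L M k 0.
Proof. by exists 0; [exact: lbracket0|rewrite ratmul0]. Qed.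

Lemma adic_ballB k x y :
  adic_ball L M k x -> adic_ball L M k y -> adic_ball L M k (x - y).
Proof.
by move=> [u Lu <-] [v Lv <-]; exists (u - v);
  [exact: lbracketB|rewrite ratmulB].
Qed.

Lemma adic_ballN k x : adic_ball L M k x -> adic_ball L M k (- x).
Proof. by move=> ?; rewrite -sub0r; apply: adic_ballB => //; exact: adic_ball0. Qed.

Lemma adic_ballD k x y :
  adic_ball L M k x -> adic_ball L M k y -> adic_ball L M k (x + y).
Proof. by move=> ? /adic_ballN ?; rewrite -[y]opprK; exact: adic_ballB. Qed.

Lemma adic_ballX k j x : adic_ball L M k x -> adic_ball L M (j + k) (ratmul (M ^ j) x).
Proof. by move=> [u Lu <-]; exists u => //; rewrite ratmulXzD. Qed.

Lemma adic_ball_le k j : (k <= j)%R -> adic_ball L M j `<=` adic_ball L M k.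
Proof.
move=> kj x; have [p ->] : exists p : nat, j = k + p%:Z.
  by exists `|j - k|%N; lia.
elim: p x => [|p IH] x; first by rewrite addr0.
move=> [u Lu <-]; apply: IH; exists (ratmul M u); first exact: lbracket_mul.
by rewrite -[in ratmul M u](expr1z M) ratmulXzD -addrA intS [1 + _]addrC.
Qed.

Lemma lparenP x : lparen L M x <-> exists k, adic_ball L M k x.
Proof.
split.
  move=> [k _ [l Ll <-]]; exists (- k%:Z).
  exists (\sum_(i < k.*2.+1) ratmul (M ^+ i) (l i)).
    by exists k.*2.+1 => //; exists l.
  rewrite ratmul_sum; apply: eq_bigr => i _.
  by rewrite exprnP ratmulXzD addrC.
move=> [k xk]; have {xk} : adic_ball L M (- `|k|%N%:Z) x.
  by apply: (@adic_ball_le _ k) => //; rewrite lerNl; lia.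
move: `|k|%N => {}k [_ /lbracketP[m [l [Ll ->]]] <-].
exists (k + m).+1 => //.
exists (fun i : 'I_((k + m).+1).*2.+1 =>
  if (m.+1 <= i < m.+1 + m)%N then l (i - m.+1)%N else 0).
  by move=> i /=; case: ifP => // _; exact: lattice0.
rewrite ratmul_sum.
have le : (m.+1 + m <= (k + m).+1.*2.+1)%N.
  by rewrite -addnn; lia.
rewrite (eq_bigr (fun i : 'I_((k + m).+1).*2.+1 =>
  if (m.+1 <= i < m.+1 + m)%N then
    ratmul (M ^ (i%:Z - (k + m).+1%:Z)) (l (i - m.+1)%N) else 0)); last first.
  by move=> i _; case: ifP => // _; rewrite ratmul0.
rewrite -(big_mkord xpredT (fun i => if (m.+1 <= i < m.+1 + m)%N then
    ratmul (M ^ (i%:Z - (k + m).+1%:Z)) (l (i - m.+1)%N) else 0)).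
rewrite -big_mkcond /= (big_cat_nat _ (n := m.+1))//=; last by lia.
rewrite big_nat_cond big1 ?add0r; last by move=> i; lia.
rewrite (big_cat_nat _ (n := m.+1 + m))//=; last by lia.
rewrite [X in _ + X]big_nat_cond [X in _ + X]big1 ?addr0; last by move=> i; lia.
rewrite -{1}[m.+1]add0n big_addn [(m.+1 + m)%N]addnC addnK big_nat_cond.
rewrite [RHS](eq_bigr (fun i : 'I_m => ratmul (M ^ (i%:Z - k%:Z)) (l i))); last first.
  by move=> i _; rewrite exprnP ratmulXzD addrC.
rewrite -(big_mkord xpredT (fun i => ratmul (M ^ (i%:Z - k%:Z)) (l i))).
rewrite [RHS]big_nat_cond; apply: eq_big => [i|i /andP[/andP[_ im] _]]; first by lia.
by rewrite addnK; congr (ratmul (M ^ _) _); lia.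
Qed.

Lemma lparen0 : lparen L M 0.
Proof. by apply/lparenP; exists 0; exact: adic_ball0. Qed.

Lemma lparenB x y : lparen L M x -> lparen L M y -> lparen L M (x - y).
Proof.
move=> /lparenP[k xk] /lparenP[j yj]; apply/lparenP; exists (Num.min k j).
by apply: adic_ballB; [apply: adic_ball_le xk|apply: adic_ball_le yj];
  rewrite ge_min lexx ?orbT.
Qed.

Lemma lparenN x : lparen L M x -> lparen L M (- x).
Proof. by move=> Px; rewrite -[- x]add0r; exact: lparenB lparen0 Px. Qed.

Lemma lparenD x y : lparen L M x -> lparen L M y -> lparen L M (x + y).
Proof. by move=> Px /lparenN Py; rewrite -[y]opprK; exact: lparenB. Qed.

Lemma lparenX j x : lparen L M x -> lparen L M (ratmul (M ^ j) x).
Proof.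
by move=> /lparenP[k xk]; apply/lparenP; exists (j + k); exact: adic_ballX.
Qed.

Lemma nu_gtNy x : lparen L M x -> (-oo < nu L M x)%E.
Proof.
move=> /lparenP[k xk]; apply: (@lt_le_trans _ _ (k%:~R)%:E); first exact: ltNyr.
apply: le_ereal_inf_tmp => _ [j /= xj <-]; rewrite lee_fin ler_int.
by rewrite leNgt; apply/negP => jk; apply: xj; apply: adic_ball_le xk; lia.
Qed.

Lemma nu0 : nu L M 0 = +oo%E.
Proof.
rewrite /nu; set S := [set _ | _ in _]; suff -> : S = set0 by rewrite ereal_inf0.
by rewrite -subset0 => _ [k /= + _]; apply; exact: adic_ball0.
Qed.

Lemma nuN x : nu L M (- x) = nu L M x.
Proof.
rewrite /nu; congr ereal_inf; congr (_ @` _); apply/seteqP; split => k /=.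
  by apply: contra_not => /adic_ballN.
by apply: contra_not => /adic_ballN; rewrite opprK.
Qed.

Lemma nuD x y : (Order.min (nu L M x) (nu L M y) <= nu L M (x + y))%E.
Proof.
apply: le_ereal_inf_tmp => _ [k /= xyk <-]; rewrite ge_min; apply/orP.
have [xk|xk] := pselect (adic_ball L M (k + 1) x); last first.
  by left; apply: ereal_inf_lbound; exists k.
right; apply: ereal_inf_lbound; exists k => //= yk.
by apply: xyk; exact: adic_ballD.
Qed.

Lemma nuX j x : ((j%:~R)%:E + nu L M x <= nu L M (ratmul (M ^ j) x))%E.
Proof.
apply: le_ereal_inf_tmp => _ [k /= xk <-].
rewrite -leeBrDl// -EFinB -intrB; apply: ereal_inf_lbound; exists (k - j) => //=.
by move=> /(@adic_ballX _ j); rewrite (_ : j + _ = k + 1)//; lia.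
Qed.

Lemma adic_abs_ge0 v : 0 <= adic_abs b v :> R.
Proof. by case: v => //= r; exact: powR_ge0. Qed.

Lemma adic_abs_le (v w : \bar R) : (-oo < v)%E -> (v <= w)%E ->
  adic_abs b w <= adic_abs b v.
Proof.
case: v w => [v| |] [w| |] //= _; rewrite ?lee_fin => vw.
by rewrite ler_powR ?lerN2// ler1n ltnW// adic_base_gt1.
Qed.

Lemma adic_absN x : N (- x) = N x. Proof. by rewrite nuN. Qed.

Lemma adic_absD x y : lparen L M x -> lparen L M y -> N (x + y) <= N x + N y.
Proof.
move=> Px Py; have := nuD x y; rewrite ge_min => /orP[] le.
  by rewrite (le_trans (adic_abs_le (nu_gtNy Px) le))// lerDl adic_abs_ge0.
by rewrite (le_trans (adic_abs_le (nu_gtNy Py) le))// lerDr adic_abs_ge0.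
Qed.

Lemma adic_absX j x : lparen L M x ->
  N (ratmul (M ^ j) x) <= b%:R `^ (- j%:~R) * N x.
Proof.
move=> Px; have b0 : b%:R != 0 :> R.
  by rewrite pnatr_eq0 -lt0n ltnW// adic_base_gt1.
have -> : b%:R `^ (- j%:~R) * N x = adic_abs b ((j%:~R)%:E + nu L M x) :> R.
  have := nu_gtNy Px; case: (nu L M x) => [r| |]//= _; last by rewrite mulr0.
  by rewrite opprD powRD// b0 implybT.
apply: adic_abs_le; last exact: nuX.
by have := nu_gtNy Px; case: (nu L M x) => [r| |]//= _; exact: ltNyr.
Qed.

(* Cauchy sequences in L(M), and the completion as their quotient by the
   sequences converging to 0. *)

Definition adic_cauchy : {pred nat -> V} := fun u =>
  `[< (forall i, lparen L M (u i)) /\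
      forall e : R, 0 < e -> exists m, forall i j : nat, (m <= i)%N -> (m <= j)%N ->
        adic_dist L M b (u i) (u j) < e >].

Lemma adic_cauchy_zmod_closed : zmod_closed adic_cauchy.
Proof.
split=> [|u v /asboolP[uP uC] /asboolP[vP vC]]; apply/asboolP; split.
- by move=> i; exact: lparen0.
- by move=> e e0; exists 0%N => i j _ _; rewrite /adic_dist subrr nu0.
- by move=> i; exact: lparenB.
move=> e e0; have e20 : 0 < e / 2 by rewrite divr_gt0.
have [m um] := uC _ e20; have [p vp] := vC _ e20; exists (maxn m p) => i j.
rewrite !geq_max => /andP[mi pi] /andP[mj pj].
rewrite [e]splitr; apply: le_lt_trans (ltrD (um _ _ mi mj) (vp _ _ pi pj)).
rewrite /adic_dist -(adic_absN (v i - v j)).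
rewrite [X in adic_abs b (nu L M X) <= _](_ : _ = (u i - u j) - (v i - v j)).
  apply: adic_absD; first exact: lparenB.
  by rewrite opprB; exact: lparenB.
rewrite -[(u - v) i]/(u i - v i) -[(u - v) j]/(u j - v j) !opprB.
by rewrite addrACA [RHS]addrACA [- v i + _]addrC.
Qed.

HB.instance Definition _ :=
  GRing.isZmodClosed.Build _ adic_cauchy adic_cauchy_zmod_closed.

Record adic_seq := AdicSeq {
  adic_fun :> nat -> V;
  adic_funP : adic_fun \in adic_cauchy }.

HB.instance Definition _ := [isSub for adic_fun].
HB.instance Definition _ := [Choice of adic_seq by <:].
HB.instance Definition _ := [SubChoice_isSubZmodule of adic_seq by <:].

Lemma adic_seqP (u : adic_seq) i : lparen L M (u i).
Proof. by case: u => u /= /asboolP[]. Qed.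

Lemma adic_seqC (u : adic_seq) (e : R) : 0 < e ->
  exists m, forall i j : nat, (m <= i)%N -> (m <= j)%N -> N (u i - u j) < e.
Proof. by case: u => u /= /asboolP[_]; exact. Qed.

Definition adic_null : {pred adic_seq} := fun u =>
  `[< adic_dist L M b (u i) 0 @[i --> \oo] --> (0 : R) >].

Lemma adic_null_zmod_closed : zmod_closed adic_null.
Proof.
split=> [|u v /asboolP u0 /asboolP v0]; apply/asboolP.
  by apply: cvg_near_cst; apply: nearW => i; rewrite /adic_dist subrr nu0.
have uv0 : adic_dist L M b (u i) 0 + adic_dist L M b (v i) 0
    @[i --> \oo] --> (0 : R) by rewrite -[X in _ --> X]addr0; exact: cvgD.
apply: (squeeze_cvgr _ (cvg_cst 0) uv0).
apply: nearW => i; rewrite adic_abs_ge0 /= /adic_dist !subr0 -(adic_absN (v i)).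
apply: adic_absD; first exact: adic_seqP.
exact: lparenN (adic_seqP v i).
Qed.

HB.instance Definition _ :=
  GRing.isZmodClosed.Build _ adic_null adic_null_zmod_closed.

Definition adic_space : Type := {ideal_quot adic_null}.

HB.instance Definition _ := GRing.Zmodule.on adic_space.

Local Open Scope quotient_scope.

Definition adic_class (u : adic_seq) : adic_space :=
  \pi_({ideal_quot adic_null}) u.

Definition adic_repr (x : adic_space) : adic_seq :=
  repr (x : {ideal_quot adic_null}).

Lemma adic_reprK : cancel adic_repr adic_class.
Proof. exact: reprK. Qed.

Lemma adic_classP u v :
  (u - v) \in adic_null <-> adic_class u = adic_class v.
Proof. by rewrite Quotient.idealrBE; split => /eqP. Qed.

Definition adic_space_dist (x y : adic_space) : R :=
  limn (fun i => adic_dist L M b (adic_repr x i) (adic_repr y i)).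

Lemma adic_dist_le (x y x' y' : V) : lparen L M x -> lparen L M y ->
  lparen L M x' -> lparen L M y' ->
  adic_dist L M b x y <= N (x - x') + N (y - y') + adic_dist L M b x' y'.
Proof.
move=> Px Py Px' Py'; rewrite /adic_dist.
have -> : x - y = (x - x') + - (y - y') + (x' - y').
  by rewrite addrAC addrA subrK opprB addrA subrK.
rewrite -(adic_absN (y - y')).
have Px0 := lparenB Px Px'; have Py0 := lparenN (lparenB Py Py').
have Pxy := lparenD Px0 Py0.
apply: le_trans (adic_absD Pxy (lparenB Px' Py')) _.
by rewrite lerD2r; exact: adic_absD.
Qed.

Lemma adic_dist_cvg (u v : adic_seq) :
  cvgn (fun i => adic_dist L M b (u i) (v i)).
Proof.
apply/cauchy_cvgP/cauchy_exP => e e0.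
have e20 : 0 < e / 2 by rewrite divr_gt0.
have [m um] := adic_seqC u e20; have [p vp] := adic_seqC v e20.
set q := maxn m p; exists (adic_dist L M b (u q) (v q)); exists q => // i /= qi.
have [mq pq] : (m <= q)%N /\ (p <= q)%N by rewrite leq_maxl leq_maxr.
have mi := leq_trans mq qi; have pi := leq_trans pq qi.
have Pu := adic_seqP u; have Pv := adic_seqP v.
have le1 := adic_dist_le (Pu i) (Pv i) (Pu q) (Pv q).
have le2 := adic_dist_le (Pu q) (Pv q) (Pu i) (Pv i).
have := um _ _ mi mq; have := um _ _ mq mi.
have := vp _ _ pi pq; have := vp _ _ pq pi.
rewrite /ball /= ltr_norml; lra.
Qed.

Lemma adic_space_distxx (x : adic_space) : adic_space_dist x x = 0.
Proof.
rewrite /adic_space_dist; apply/cvg_lim => //; apply: cvg_near_cst.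
by apply: nearW => i; rewrite /adic_dist subrr nu0.
Qed.

Lemma adic_space_dist_sym (x y : adic_space) : adic_space_dist x y = adic_space_dist y x.
Proof.
rewrite /adic_space_dist.
by under eq_fun do rewrite /adic_dist -adic_absN opprB.
Qed.

Lemma adic_space_dist_eq0 (x y : adic_space) : adic_space_dist x y = 0 -> x = y.
Proof.
move=> d0; rewrite -[x]adic_reprK -[y]adic_reprK; apply/adic_classP/asboolP.
rewrite -d0 /adic_space_dist.
under eq_fun do rewrite {1}/adic_dist subr0.
exact: adic_dist_cvg.
Qed.

Lemma adic_space_dist_triangle (y x z : adic_space) :
  adic_space_dist x z <= adic_space_dist x y + adic_space_dist y z.
Proof.
have cvgd := adic_dist_cvg.
rewrite /adic_space_dist -limD//; apply: ler_lim => //; first exact: is_cvgD.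
apply: nearW => i /=; have P u := adic_seqP u i.
rewrite /adic_dist -[X in adic_abs b (nu L M X) <= _](subrKA (adic_repr y i)).
by apply: adic_absD; exact: lparenB.
Qed.

HB.instance Definition _ := isMetric.Build R adic_space
  adic_space_distxx adic_space_dist_eq0 adic_space_dist_sym
  adic_space_dist_triangle.

Definition adic_nu (x : adic_space) : \bar R :=
  limn (fun i => nu L M (adic_repr x i)).

Lemma adic_scale_cauchy (j : int) (u : adic_seq) :
  (fun i => ratmul (M ^ j) (u i)) \in adic_cauchy.
Proof.
apply/asboolP; split=> [i|e e0]; first exact/lparenX/adic_seqP.
have c0 : 0 < b%:R `^ (- j%:~R) :> R.
  by rewrite powR_gt0// ltr0n ltnW// adic_base_gt1.
have [m um] := adic_seqC u (divr_gt0 e0 c0); exists m => p q mp mq.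
rewrite /adic_dist -ratmulB.
have Ppq := lparenB (adic_seqP u p) (adic_seqP u q).
by rewrite (le_lt_trans (adic_absX j Ppq))// mulrC -ltr_pdivlMr// um.
Qed.

Definition adic_scale (j : int) (x : adic_space) : adic_space :=
  adic_class (AdicSeq (adic_scale_cauchy j (adic_repr x))).

Lemma adic_cst_cauchy (x : V) : lparen L M x -> (fun=> x) \in adic_cauchy.
Proof.
move=> Px; apply/asboolP; split=> // e e0; exists 0%N => i j _ _.
by rewrite /adic_dist subrr nu0.
Qed.

(* the canonical map L(M) -> L((M)), extended by 0 outside L(M) *)
Definition adic_embed (x : V) : adic_space := adic_class (insubd 0 (fun=> x)).

(* sum over v <= i < j of M^i w_i *)
Definition adic_sum (w : int -> V) (v : \bar R) (j : int) : V :=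
  \sum_(i \in [set i : int | (v <= (i%:~R)%:E)%E /\ i < j])
    ratmul (M ^ i) (w i).

Definition adic_expansion (E : set V) (y : adic_space) (w : int -> V) : Prop :=
  [/\ forall j : int, (adic_nu y <= (j%:~R)%:E)%E -> E (w j),
      forall j : int, ((j%:~R)%:E < adic_nu y)%E -> w j = 0 &
      adic_embed (adic_sum w (adic_nu y) m%:Z) @[m --> \oo] --> y].

(* the unique expansion of y with digits in E *)
Definition adic_digits (E : set V) (y : adic_space) : int -> V :=
  xget (fun=> 0) [set w | adic_expansion E y w].

Definition adic_frac (E : set V) (y : adic_space) : V :=
  adic_sum (adic_digits E y) (adic_nu y) 0.

End Completion.


(* R^n x L((M)); the product pseudometric of the library is the maximum of the
   two distances, the one on 'cV[R]_n.+1 being given by the sup norm. *)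
Definition adic_product (R : realType) n (D : adic_system R n) : Type :=
  ('cV[R]_n.+1 * adic_space D)%type.

HB.instance Definition _ (R : realType) n (D : adic_system R n) :=
  GRing.Zmodule.on (adic_product D).
HB.instance Definition _ (R : realType) n (D : adic_system R n) :=
  PseudoMetric.on (adic_product D).

Section Characters.
Context {R : realType}.

Definition expi (t : R) : R[i] := (cos t +i* sin t)%C.

(* R[i]^o carries the topology of the modulus *)
Definition is_character (G : PreTopologicalZmodule.type) (chi : G -> R[i]) :
    Prop :=
  [/\ forall g, `|chi g| = 1,
      forall g h, chi (g + h) = chi g * chi h &
      continuous (chi : G -> R[i]^o)].

Definition characters (G : PreTopologicalZmodule.type) : set (G -> R[i]) :=
  [set chi | is_character chi].

End Characters.

Arguments characters {R} G.

Lemma expanding_unit (R : realType) n (A : 'M[rat]_n.+1) :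
  expanding R A -> A \is a GRing.unit.
Proof.
move=> hA; case: (boolP (A \is a GRing.unit)) => // nA.
have : eigenvalue (map_mx ratr A : 'M[R[i]]_n.+1) 0.
  rewrite /eigenvalue /eigenspace raddf0 subr0 kermx_eq0 row_free_unit.
  by rewrite map_unitmx; exact: nA.
by move=> /hA; rewrite normr0 ltr10.
Qed.

Lemma expanding_inv_unit (R : realType) n (A : 'M[rat]_n.+1) :
  expanding R A -> A^-1 \is a GRing.unit.
Proof. by rewrite unitrV; exact: expanding_unit. Qed.

Lemma expanding_inv_tr_unit (R : realType) n (A : 'M[rat]_n.+1) :
  expanding R A -> (A^-1)^T \is a GRing.unit.
Proof.
move=> /expanding_inv_unit Au; have {Au} : A^-1 \in unitmx by [].
by rewrite -unitmx_tr.
Qed.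

Section Spaces.
Context {R : realType} {n : nat} {A : 'M[rat]_n.+1}.
Hypothesis (hA : expanding R A).
Hypothesis (hb : (2 <= adic_index (Zlattice R n) A^-1)%N).

(* Z^n((B)) *)
Definition sysB : adic_system R n :=
  AdicSystem (Zlattice R n) (expanding_inv_unit hA) hb.

(* The completion of Gamma(B^T), with the same base b as Z^n((B)). *)
Definition sysBstar (Gamma : lattice R n) : adic_system R n :=
  AdicSystem Gamma (expanding_inv_tr_unit hA) hb.

Definition K_A : Type := adic_product sysB.

(* S_s(y); \sum_(j \in _) is the sum over the finitely many nonzero terms. *)
Definition adic_pairing (Gamma : lattice R n) (E Estar : set 'cV[R]_n.+1)
    (s : adic_space (sysBstar Gamma)) (y : adic_space sysB) : R :=
  \sum_(j \in [set j : int | (adic_nu s <= (j%:~R)%:E)%E])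
    dotp (adic_frac E (adic_scale j y)) (adic_digits Estar s j).

Definition chi_char (Gamma : lattice R n) (E Estar : set 'cV[R]_n.+1)
    (rs : adic_product (sysBstar Gamma)) (xy : K_A) : R[i] :=
  expi (2 * pi * dotp xy.1 rs.1) * expi (2 * pi * adic_pairing E Estar rs.2 xy.2).

End Spaces.

(* Main.v *)
Require Import Defs.
From HB Require Import structures.
From mathcomp Require Import all_boot all_order all_algebra.
From mathcomp Require Import finmap complex.
From mathcomp Require Import zify ring lra.
From mathcomp Require Import all_classical all_reals all_analysis.

Set Implicit Arguments.
Unset Strict Implicit.
Unset Printing Implicit Defensive.

Import Order.TTheory GRing.Theory Num.Theory.
Import numFieldNormedType.Exports.

Local Open Scope classical_set_scope.
Local Open Scope ring_scope.

(** Write [B] for the inverse of [A], [X = L(M)] for a system with lattice [L]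
    and matrix [M], and call fractional part of [y] modulo [L[M]] any vector
    of [L[M^-1]] lying within the closed unit ball of [y].

    Two fractional parts of the same point differ by an element of
    [L[M] :&: L[M^-1]]. For [Z^n] and [B] this intersection lies in [Lambda],
    for [Gamma] and [B^T] it lies in the dual of [Lambda], hence in [Z^n]. Since
    the digits of [s] lie in [Gamma], and so pair integrally with [Lambda], the
    number [S_s(y)] modulo [Z] only depends on the fractional parts of the
    [B^j y]; so it is additive in [y] ([pairingDr]). It vanishes when [y] is
    small, which gives continuity. On the generators [B^i e] of [Z^n(B)], with
    [e] in [Z^n], one computes that [S_s(B^i e)] is the product of [e] with a
    fractional part of [B^T^i s] modulo [Z] ([pairing_pow]). This makes
    [S_s(y)] additive in [s] too ([pairingDl]), and it reduces the study of
    [s |-> exp (2 pi i S_s)] to that of sequences of fractional parts.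

    These sequences are easily recognised ([adic_of_fractions]): a sequence
    [t_i] which vanishes for large [i] and satisfies [t_(i+1) = B^T t_i] modulo
    [Gamma] comes from the point [s] obtained as the limit of [B^T^(-i) t_i].
    A character [psi] of [Z^n(B)] trivial on a ball has the form
    [psi (B^i e) = exp (2 pi i <e, q_i>)] on the generators, and the [q_i]
    satisfy this recursion only up to bounded denominators: one has to
    multiply them by some [N], so that [psi^N], instead of [psi], is seen to
    come from a point [s] ([fractions_of_root]). Similarly, if the character of
    [s] is trivial then all fractional parts of the [B^T^i s] are integral, and
    only a multiple [m s] is seen to vanish ([adic_character_inj]).

    Both defects are repaired by arithmetic. If [f] is a primitive integral
    polynomial annihilating [M] and [p] is a prime, then modulo [p] it is
    ['X^c] times a polynomial with invertible constant term, so that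
    [M^c = p a(M) + M^(c+k) r(M)] for all [k], with integral polynomials [a] and
    [r]; products give the same for every [N > 0] ([power_splits_ex]). Hence
    [N x] can be small only if [x] is small ([adic_ball_torsion]), and [N X] is
    dense in [X] ([lparen_dense_multiples]). So the completions have no
    torsion, and each character of [X] trivial on a ball has an [N]-th root
    with the same property ([adic_hom_root]), to which the preceding paragraph
    applies.

    Finally a character of [K_A] is the product of its restrictions to the two
    factors. The restriction to [R^n] is determined on each coordinate axis by
    its values at small dyadic multiples of one number ([character_line]); the
    other one is trivial on a ball because the circle has no small subgroups
    ([no_small_subgroup]). *)

(** * The circle group and the characters of the line *)

Section Circle.
Context {R : realType}.
Implicit Types (t : R) (z : R[i]).

Local Notation Re := complex.Re.
Local Notation Im := complex.Im.

Lemma expiD t u : expi (t + u) = expi t * expi u.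
Proof. by rewrite /expi cosD sinD; simpc; rewrite [X in (_ +i* X)%C]addrC. Qed.

Lemma expi0 : expi (0 : R) = 1.
Proof. by rewrite /expi cos0 sin0. Qed.

Lemma expi_neq0 t : expi t != 0.
Proof.
apply/eqP => t0; have := expiD t (- t).
by rewrite t0 mul0r subrr expi0 => /eqP; rewrite oner_eq0.
Qed.

Lemma expiN t : expi (- t) = (expi t)^-1.
Proof.
apply: (mulfI (expi_neq0 t)).
by rewrite -expiD subrr expi0 mulfV// expi_neq0.
Qed.

Lemma expiMn t k : expi (t *+ k) = expi t ^+ k.
Proof.
by elim: k => [|k IH]; rewrite ?mulr0n ?expi0// mulrS expiD IH exprS.
Qed.

Lemma norm_expi t : `|expi t| = 1.
Proof. by rewrite normc_def /= cos2Dsin2 sqrtr1. Qed.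

Lemma expi_2pi : expi (2 * pi : R) = 1.
Proof. by rewrite mulr_natl /expi cos2pi sin2pi. Qed.

Lemma expi_int (m : int) : expi (2 * pi * m%:~R : R) = 1.
Proof.
have H (k : nat) : expi (2 * pi * k%:R : R) = 1.
  by rewrite mulr_natr expiMn expi_2pi expr1n.
by case: m => k; rewrite ?NegzE ?mulrNz ?mulrN ?expiN H// invr1.
Qed.

Lemma expi_half : expi (2 * pi * 2^-1 : R) = -1.
Proof.
rewrite mulrAC divff// mul1r /expi cospi sinpi.
by apply/eqP; rewrite eq_complex /= oppr0 !eqxx.
Qed.

Lemma sqr_unit z : `|z| = 1 -> Re z ^+ 2 + Im z ^+ 2 = 1.
Proof. by move=> z1; apply: complexI; rewrite add_Re2_Im2 z1 expr1n. Qed.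

Lemma Re_unit_le1 z : `|z| = 1 -> Re z <= 1.
Proof. by move=> /sqr_unit h; nra. Qed.

Lemma Re_unit_eq1 z : `|z| = 1 -> Re z = 1 -> z = 1.
Proof.
case: z => a b /sqr_unit /= h a1; rewrite a1 in h *.
have -> : b = 0 by nra.
by [].
Qed.

Lemma expi_eq1 t : expi (2 * pi * t) = 1 -> exists m : int, t = m%:~R.
Proof.
move=> t1; exists (Num.floor t); set m := Num.floor t.
have [ge0 lt1] : 0 <= t - m%:~R /\ t - m%:~R < 1.
  by have /andP[] := floor_itv t; rewrite intrD -/m; lra.
set f := t - m%:~R in ge0 lt1.
have : expi (2 * pi * f) = 1 by rewrite mulrBr expiD expiN t1 expi_int divr1.
move=> /(congr1 (fun z => Re z)) /=; rewrite -mulrA mulr_natl cos_mulr2n => cos1.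
apply/eqP; rewrite -subr_eq0 -/f; apply/eqP; apply/eqP; apply: contraT => f0.
have f_gt0 : 0 < f by rewrite lt_neqAle eq_sym f0.
have p0 := pi_gt0 R.
have : 0 < sin (pi * f) by apply: sin_gt0_pi; apply/andP; split; nra.
by have := cos2Dsin2 (pi * f); nra.
Qed.

Lemma unit_expi_pihalf z : `|z| = 1 -> 0 <= Re z ->
  exists t, - (pi / 2) <= t <= pi / 2 /\ z = expi t.
Proof.
case: z => a b /sqr_unit /= h a0.
have b1 : -1 <= b <= 1 by apply/andP; split; nra.
have [itv sinb] := asin_def b1.
exists (asin b); split=> //; rewrite /expi sinb cos_asin//.
have -> : 1 - b ^+ 2 = a ^+ 2 by rewrite -h addrK.
by rewrite sqrtr_sqr ger0_norm.
Qed.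

Lemma unit_expi z : `|z| = 1 -> exists t, z = expi (2 * pi * t).
Proof.
move=> z1; have p0 := pi_gt0 R.
suff [t zt] : exists t, z = expi t.
  exists (t / (2 * pi)); rewrite zt; congr expi.
  by rewrite mulrC divfK// gt_eqF// mulr_gt0// ltr0n.
have [Rez|Rez] := leP 0 (Re z).
  by have [u [_ zu]] := unit_expi_pihalf z1 Rez; exists u.
have Nz1 : `|- z| = 1 by rewrite normrN.
have NRez : 0 <= Re (- z) by case: z {z1 Nz1} Rez => a b /=; lra.
have [u [_ zu]] := unit_expi_pihalf Nz1 NRez.
exists (u + pi); rewrite expiD -zu.
rewrite (_ : expi pi = -1) ?mulrNN ?mulr1//.
by rewrite -expi_half mulrAC divff ?mul1r ?pnatr_eq0.
Qed.

(** Squaring a point with [Re z > 1/2] at least triples its defect [1 - Re z],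
    which therefore cannot stay below [1/2] along the powers of [z] unless it
    vanishes. *)
Lemma no_small_subgroup z : `|z| = 1 ->
  (forall k, 2^-1 < Re (z ^+ k)) -> z = 1.
Proof.
move=> z1 Hz; apply: Re_unit_eq1 => //; apply/eqP; rewrite eq_le Re_unit_le1//=.
apply/contraT; rewrite -ltNge => Rez1.
have step k : 1 - Re z <= 1 - Re (z ^+ (2 ^ k)) /\
    k%:R * (1 - Re z) <= 1 - Re (z ^+ (2 ^ k)).
  elim: k => [|k [IH1 IH2]]; first by rewrite mul0r expr1; split; lra.
  have u1 : `|z ^+ (2 ^ k)| = 1 by rewrite normrX z1 expr1n.
  rewrite expnSr exprM expr2; move: (Hz (2 ^ k)%N) IH1 IH2 u1.
  case: (z ^+ (2 ^ k)) => a b /= a2 IH1 IH2 /sqr_unit /= h.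
  rewrite -natr1 mulrDl mul1r; split; nra.
have [k kz] : exists k : nat, (1 - Re z)^-1 < k%:R.
  by exists (Num.truncn (1 - Re z)^-1).+1; rewrite truncnS_gt.
have [_] := step k; have := Hz (2 ^ k)%N.
have : 1 < k%:R * (1 - Re z) by rewrite -ltr_pdivrMr ?div1r//; lra.
lra.
Qed.

(** A multiplicative form of continuity at [1]: the factor [4] is what a crude
    bound on the product of the imaginary parts costs. *)
Lemma Re_unitM z w (e : R) : `|z| = 1 -> `|w| = 1 -> 0 <= e <= 1 ->
  1 - e <= Re z -> 1 - e <= Re w -> 1 - 4 * e <= Re (z * w).
Proof.
case: z w => a b [c d] /sqr_unit /= ab /sqr_unit /= cd /andP[e0 e1] ae ce.
have : b * d <= 2 * e by have := sqr_ge0 (b - d); nra.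
nra.
Qed.

(** A character agrees with some [expi (c t)] at one small [d]. Of the two
    square roots of a value near [1] only one is near [1], so they agree at
    all [d / 2 ^ k], hence on a dense subgroup. *)
Lemma character_line (h : R -> R[i]) :
  (forall t, `|h t| = 1) -> (forall t u, h (t + u) = h t * h u) ->
  (forall a, a < 1 -> \forall t \near 0, a < Re (h t)) ->
  exists c, forall t, h t = expi (2 * pi * (t * c)).
Proof.
move=> h1 hD hC.
have /hC[d0 /= d0_gt0 hd0] : 2^-1 < 1 :> R by lra.
have {}hd0 t : `|t| < d0 -> 2^-1 < Re (h t).
  by move=> td; apply: hd0; rewrite /ball_/= sub0r normrN.
pose d := d0 / 2; have d_gt0 : 0 < d by rewrite divr_gt0.
have dd0 : d < d0 by rewrite /d; lra.
have Rehd : 0 <= Re (h d).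
  by have := hd0 d; rewrite gtr0_norm// => /(_ dd0); lra.
have [th [/andP[th1 th2] hth]] := unit_expi_pihalf (h1 d) Rehd.
pose c := th / d.
pose H t := h t * expi (- (c * t)).
have HD t u : H (t + u) = H t * H u.
  by rewrite /H hD mulrDr opprD expiD mulrACA.
have H1 t : `|H t| = 1 by rewrite /H normrM h1 norm_expi mulr1.
(* [H] measures the quotient of [h] by [expi (c t)]. The root [-1] is excluded
   because [h u] and [expi (c u)] both lie in the right half plane. *)
have Hd k : H (d / 2 ^+ k) = 1.
  elim: k => [|k IH].
    rewrite expr0 divr1 /H hth -expiD /c mulfVK ?subrr ?expi0//.
    by rewrite gt_eqF.
  set u := d / 2 ^+ k.+1 in IH *.
  have uu : d / 2 ^+ k = u + u.
    by rewrite /u exprS; field; rewrite expf_neq0//; lra.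
  have k0 : 1 <= 2 ^+ k.+1 :> R by rewrite exprn_ege1//; lra.
  have u_gt0 : 0 < u by rewrite divr_gt0// exprn_gt0.
  have ud : u <= d by rewrite /u ler_pdivrMr ?exprn_gt0//; nra.
  move: IH; rewrite uu HD -expr2 => /eqP; rewrite sqrf_eq1 => /orP[/eqP //|/eqP HN].
  have hu : h u = - expi (c * u).
    by rewrite -mulN1r -HN /H -mulrA -expiD addNr expi0 mulr1.
  have := hd0 u; rewrite gtr0_norm// => /(_ (le_lt_trans ud dd0)).
  rewrite hu /= ltNge => /negP; case.
  suff : 0 <= cos (c * u) by lra.
  apply: cos_ge0_pihalf.
  have ud1 : 0 <= u / d <= 1.
    by rewrite (divr_ge0 (ltW u_gt0) (ltW d_gt0)) /= ler_pdivrMr// mul1r.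
  have -> : c * u = th * (u / d) by rewrite /c mulrAC -mulrA.
  have p0 := pi_gt0 R; case/andP: ud1 => ud0 ud1.
  by apply/andP; split; nra.
suff HT t : H t = 1.
  exists (c / (2 * pi)) => t; rewrite -[LHS]mulr1 -expi0 -(addNr (c * t)).
  rewrite expiD mulrA -/(H t) HT mul1r; congr expi.
  by rewrite mulrCA [2 * pi * _]mulrC divfK ?[t * c]mulrC// gt_eqF ?mulr_gt0 ?pi_gt0.
(* By density: [t] is a multiple of some tiny [u = d / 2 ^ k] plus a remainder
   [rho] with [0 <= rho < u], so that [H t = H rho] is close to [1]. *)
apply: Re_unit_eq1 => //; apply/eqP; rewrite eq_le Re_unit_le1//=.
apply/ler_addgt0Pr => e e0.
pose e' := Num.min (e / 4) 1.
have e'0 : 0 < e' by rewrite lt_min ltr01 andbT divr_gt0.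
have e'1 : 0 <= e' <= 1 by rewrite ltW//= ge_min lexx orbT.
have e'4 : 4 * e' <= e.
  have : e' <= e / 4 by rewrite ge_min lexx.
  lra.
have /hC hn : 1 - e' < 1 by lra.
have cn : \forall t \near 0, 1 - e' < cos (- (c * t)).
  have cc : {for 0, continuous (fun t => cos (- (c * t)))}.
    apply: continuous_comp; last exact: continuous_cos.
    by apply: cvgN; apply: cvgM; [exact: cvg_cst|exact: cvg_id].
  have : 1 - e' < cos (- (c * 0)) by rewrite mulr0 oppr0 cos0; lra.
  by move=> lt; exact: (cvgr_gt _ cc _ lt).
have [d1 /= d1_gt0 hd1] := filterI hn cn.
have [k hk] : exists k, d / 2 ^+ k < d1.
  have [k kk] : exists k : nat, d / d1 < k%:R.
    by exists (Num.truncn (d / d1)).+1; rewrite truncnS_gt.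
  exists k; rewrite ltr_pdivrMr ?exprn_gt0//.
  rewrite ltr_pdivrMr// in kk; apply: lt_trans kk _; rewrite mulrC ltr_pM2l//.
  by rewrite -natrX ltr_nat ltn_expl.
set u := d / 2 ^+ k in hk.
have u_gt0 : 0 < u by rewrite divr_gt0// exprn_gt0.
have Hnat (j : nat) : H (j%:R * u) = 1.
  elim: j => [|j IH]; last by rewrite -natr1 mulrDl mul1r HD IH mul1r; exact: Hd.
  have := HD 0 0; rewrite addr0 mul0r => /eqP.
  have H0 : H 0 != 0 by rewrite -normr_eq0 H1 oner_eq0.
  by rewrite -{1}[H 0]mulr1 => /eqP /(mulfI H0).
have Hint (j : int) : H (j%:~R * u) = 1.
  case: j => j; first exact: Hnat.
  have := HD (- (j.+1%:R * u)) (j.+1%:R * u).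
  rewrite addNr Hnat mulr1 NegzE mulrNz mulNr => <-.
  by have := Hnat 0%N; rewrite mul0r.
have /andP[f1 f2] := floor_itv (t / u).
set j := Num.floor (t / u) in f1 f2.
pose rho := t - j%:~R * u.
have rho0 : 0 <= rho.
  by rewrite /rho subr_ge0 -ler_pdivlMr.
have rhou : rho < u.
  move: f2; rewrite ltr_pdivrMr// intrD mulrDl mul1r /rho; lra.
have Ht : H t = H rho by rewrite -[in LHS](subrK (j%:~R * u) t) HD Hint mulr1.
have [|hr1 hr2] := hd1 rho.
  by rewrite /ball_/= sub0r normrN ger0_norm// (lt_trans rhou hk).
have : 1 - 4 * e' <= Re (H rho).
  by apply: Re_unitM => //; [exact: norm_expi|exact: ltW|exact: ltW].
by rewrite Ht; lra.
Qed.

Lemma expi_continuous : continuous (expi : R -> R[i]^o).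
Proof.
move=> t; apply/cvgrPdist_lt => /= e e0.
have [e1 ee] : exists e1 : R, 0 < e1 /\ e = e1%:C%C.
  by case: e e0 => e1 e2; rewrite ltcE /= => /andP[/eqP -> e10]; exists e1.
have e20 : 0 < e1 / 2 by lra.
have /cvgrPdist_lt /(_ _ e20) C := @continuous_cos R t.
have /cvgrPdist_lt /(_ _ e20) S := @continuous_sin R t.
near=> u; rewrite ee.2.
have -> : expi t - expi u = ((cos t - cos u)%:C + 'i * (sin t - sin u)%:C)%C.
  by rewrite /expi; simpc.
apply: le_lt_trans (ler_normD _ _) _; rewrite normrM normc_def /=.
rewrite !normc_def /= !expr0n /= !addr0 !add0r expr1n sqrtr1 !sqrtr_sqr mul1r.
rewrite -rmorphD /= ltcR [e1]splitr; apply: ltrD.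
- by near: u.
- by near: u.
Unshelve. all: by end_near. Qed.

(** On the unit circle, closeness to [1] is measured by the real part, a real
    number unlike the norm of the field of complex numbers. *)
Lemma continuous_Re (T : topologicalType) (f : T -> R[i]) (x : T) (a : R) :
  continuous (f : T -> R[i]^o) -> a < Re (f x) ->
  \forall y \near x, a < Re (f y).
Proof.
move=> fC ax.
have e0 : 0 < (Re (f x) - a)%:C%C by rewrite ltcR subr_gt0.
have /cvgrPdist_lt /(_ _ e0) C := fC x.
near=> y.
have : `|f x - f y| < (Re (f x) - a)%:C%C by near: y.
move=> /(le_lt_trans (normc_ge_Re _)); rewrite ltcR ltr_norml => /andP[_].
by case: (f x) (f y) => p q [r s] /=; lra.
Unshelve. all: by end_near. Qed.

End Circle.

(** * Integer vectors, rational matrices and the characters of Euclidean space *)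

Section RationalAction.
Context {R : realType} {n : nat}.
Implicit Types (K : 'M[rat]_n.+1) (x y : 'cV[R]_n.+1).

Lemma ratmulDl K K' x : ratmul (K + K') x = ratmul K x + ratmul K' x.
Proof. by rewrite /ratmul map_mxD mulmxDl. Qed.

Lemma ratmul1 x : ratmul 1 x = x.
Proof. by rewrite /ratmul -[1]/(1%:M) map_mx1 mul1mx. Qed.

Lemma ratmulMz K x (m : int) : ratmul (K *~ m) x = ratmul K x *~ m.
Proof.
have H (k : nat) : ratmul (K *+ k) x = ratmul K x *+ k.
  by elim: k => [|k IH]; rewrite ?mulrS ?ratmulDl ?IH// /ratmul map_mx0 mul0mx.
case: m => k; first exact: H.
by rewrite !NegzE !mulrNz -!pmulrn -H /ratmul map_mxN mulNmx.
Qed.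

Lemma ratmul_nat (N : nat) x : ratmul N%:R x = x *+ N.
Proof. by rewrite [RHS]pmulrn -[x in RHS]ratmul1 -ratmulMz -pmulrn. Qed.

Lemma ratmulMn K x N : ratmul K (x *+ N) = ratmul K x *+ N.
Proof. by elim: N => [|N IH]; rewrite ?ratmul0 ?mulrS ?ratmulD ?IH. Qed.

End RationalAction.

Section DotProduct.
Context {R : realType} {n : nat}.
Implicit Types (x y z : 'cV[R]_n.+1).

Lemma dotpE x y : dotp x y = (x^T *m y) 0 0.
Proof. by rewrite mxE; apply: eq_bigr => i _; rewrite mxE. Qed.

Lemma dotpC x y : dotp x y = dotp y x.
Proof. by apply: eq_bigr => i _; rewrite mulrC. Qed.

Lemma dotpDr x y z : dotp x (y + z) = dotp x y + dotp x z.
Proof. by rewrite !dotpE mulmxDr mxE. Qed.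

Lemma dotpBr x y z : dotp x (y - z) = dotp x y - dotp x z.
Proof. by rewrite !dotpE mulmxBr !mxE. Qed.

Lemma dotp0 x : dotp x 0 = 0.
Proof. by rewrite dotpE mulmx0 mxE. Qed.

Lemma dotpDl x y z : dotp (x + y) z = dotp x z + dotp y z.
Proof. by rewrite ![dotp _ z]dotpC dotpDr. Qed.

Lemma dotpBl x y z : dotp (x - y) z = dotp x z - dotp y z.
Proof. by rewrite ![dotp _ z]dotpC dotpBr. Qed.

Lemma dot0p x : dotp 0 x = 0.
Proof. by rewrite dotpC dotp0. Qed.

Lemma dotp_sumr x I (r : seq I) (P : pred I) (F : I -> 'cV[R]_n.+1) :
  dotp x (\sum_(i <- r | P i) F i) = \sum_(i <- r | P i) dotp x (F i).
Proof. exact: (big_morph (dotp x) (dotpDr x) (dotp0 x)). Qed.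

Lemma dotpMnr x y N : dotp x (y *+ N) = dotp x y *+ N.
Proof. by elim: N => [|N IH]; rewrite ?dotp0// !mulrS dotpDr IH. Qed.

Lemma dotp_ratmul (K : 'M[rat]_n.+1) x y :
  dotp (ratmul K x) y = dotp x (ratmul K^T y).
Proof. by rewrite !dotpE /ratmul trmx_mul map_trmx mulmxA. Qed.

Lemma dotp_delta (i : 'I_n.+1) y : dotp (delta_mx i 0) y = y i 0.
Proof.
rewrite /dotp (bigD1 i)//= mxE !eqxx mul1r big1 ?addr0// => j /negPf ji.
by rewrite mxE ji mul0r.
Qed.

Lemma int_vectorsP x : int_vectors x <-> forall i, x i 0 \is a Num.int.
Proof.
split=> [[z _ <-] i|H]; first by rewrite mxE; exact: intr_int.
exists (\col_i Num.floor (x i 0)) => //; apply/matrixP => i j.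
by rewrite !mxE ord1 floorK.
Qed.

Lemma int_vectorsB x y : int_vectors x -> int_vectors y -> int_vectors (x - y).
Proof.
move=> /int_vectorsP Hx /int_vectorsP Hy; apply/int_vectorsP => i.
by rewrite !mxE rpredB.
Qed.

Lemma dotp_int x y : int_vectors x -> int_vectors y -> dotp x y \is a Num.int.
Proof.
move=> /int_vectorsP Hx /int_vectorsP Hy.
by apply: rpred_sum => i _; rewrite rpredM.
Qed.

Lemma int_vectors_delta i : int_vectors (delta_mx i 0 : 'cV[R]_n.+1).
Proof. by apply/int_vectorsP => j; rewrite mxE natr_int. Qed.

Lemma int_vectors_dotp x :
  (forall e, int_vectors e -> dotp e x \is a Num.int) -> int_vectors x.
Proof.
move=> H; apply/int_vectorsP => i; rewrite -dotp_delta.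
exact/H/int_vectors_delta.
Qed.

Lemma tr_expz (K : 'M[rat]_n.+1) (k : int) : (K ^ k)^T = K^T ^ k.
Proof.
have H (i : nat) : (K ^+ i)^T = K^T ^+ i.
  elim: i => [|i IH]; first by rewrite !expr0; exact: trmx1.
  by rewrite exprS exprSr -IH; exact: trmx_mul.
case: k => i; first exact: H.
by rewrite !NegzE -!exprnN -H; exact: trmx_inv.
Qed.

End DotProduct.

Lemma int_vectors_gen (R : realType) n (P : 'cV[R]_n.+1 -> Prop) : P 0 ->
  (forall x y, int_vectors x -> int_vectors y -> P x -> P y -> P (x - y)) ->
  (forall i, P (delta_mx i 0)) -> forall x, int_vectors x -> P x.
Proof.
move=> P0 PB Pd x /int_vectorsP Zx.
pose Q y := int_vectors y /\ P y.
have Z0 : int_vectors (0 : 'cV[R]_n.+1) by apply/int_vectorsP => i; rewrite mxE.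
have QB y z : Q y -> Q z -> Q (y - z).
  by move=> [Zy Py] [Zz Pz]; split; [exact: int_vectorsB|exact: PB].
have QN y : Q y -> Q (- y) by rewrite -sub0r; exact: QB.
have QD y z : Q y -> Q z -> Q (y + z).
  by move=> Qy /QN Qz; rewrite -[z]opprK; exact: QB.
have Qz (m : int) y : Q y -> Q (y *~ m).
  move=> Qy; have Qn (k : nat) : Q (y *+ k).
    by elim: k => [|k IH]; [split|rewrite mulrS; exact: QD].
  by case: m => k; rewrite ?NegzE ?mulrNz -pmulrn//; exact: QN.
suff [] : Q x by [].
have -> : x = \sum_i delta_mx i 0 *~ Num.floor (x i 0).
  apply/matrixP => i j; rewrite ord1 summxE (bigD1 i)//= big1.
    rewrite addr0 -scaler_int !mxE !eqxx mulr1 floorK//.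
  move=> l /negPf li; rewrite -scaler_int !mxE eq_sym li mulr0//.
elim/big_rec: _ => [|i y _ Qy]; first by split.
by apply: QD => //; apply: Qz; split; [exact: int_vectors_delta|exact: Pd].
Qed.

Lemma common_denominator (R : realType) n (K : 'M[rat]_n.+1) :
  exists2 d, (0 < d)%N & forall x : 'cV[R]_n.+1, int_vectors x ->
    int_vectors (ratmul K (x *+ d)).
Proof.
pose d : nat := (\prod_i \prod_j `|denq (K i j)|)%N.
have Kd i j : K i j *+ d \is a Num.int.
  have /dvdnP[q ->] : (`|denq (K i j)| %| d)%N.
    by rewrite /d (bigD1 i)//= (bigD1 j)//= -!mulnA dvdn_mulr.
  have -> : K i j *+ (q * `|denq (K i j)|) = (numq (K i j) * q%:Z)%:~R.
    by rewrite -mulr_natr mulnC natrM mulrA natr_absz normr_denq -numqE intrM.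
  exact: intr_int.
exists d.
  apply: prodn_cond_gt0 => i _; apply: prodn_cond_gt0 => j _.
  by rewrite absz_gt0 denq_neq0.
move=> x /int_vectorsP Zx; apply/int_vectorsP => i.
rewrite ratmulMn mulmxnE mxE -sumrMnl; apply: rpred_sum => j _.
rewrite mxE -mulrnAl; apply: rpredM => //.
have /intrP[m mE] := Kd i j.
by rewrite -rmorphMn /= mE ratr_int intr_int.
Qed.

(** If [P] is a basis matrix then [P] is integral and [P (adj P) = det P], so
    that [|det P|] sends [Z^n] into the lattice. *)
Lemma int_lattice_index (R : realType) n (G : set 'cV[R]_n.+1) :
  full_lattice G -> G `<=` int_vectors ->
  exists2 m, (0 < m)%N & forall x, int_vectors x -> G (x *+ m).
Proof.
move=> [P Pu GE] GZ.
have Pint i j : P i j \is a Num.int.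
  have : int_vectors (P *m map_mx intr (delta_mx j 0 : 'cV[int]_n.+1)).
    by apply: GZ; rewrite GE; exists (delta_mx j 0).
  move=> /int_vectorsP /(_ i); rewrite map_delta_mx -colE mxE.
  by [].
pose P0 : 'M[int]_n.+1 := \matrix_(i, j) Num.floor (P i j).
have PE : P = map_mx intr P0 by apply/matrixP => i j; rewrite !mxE floorK.
have d0 : \det P0 != 0.
  have : \det P != 0 by rewrite -unitfE -unitmxE.
  by rewrite PE det_map_mx intr_eq0.
exists `|\det P0|%N; first by rewrite absz_gt0.
move=> _ [z _ <-]; rewrite GE; exists (sgz (\det P0) *: (\adj P0 *m z)) => //.
rewrite PE -map_mxM /= -scalemxAr mulmxA mul_mx_adj mul_scalar_mx scalerA.
rewrite -abszEsg; apply/matrixP => i j; rewrite mulmxnE !mxE intrM.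
by rewrite -pmulrn mulr_natl.
Qed.

Lemma int_vectors_character (R : realType) n (F : 'cV[R]_n.+1 -> R[i]) :
  (forall e, int_vectors e -> `|F e| = 1) ->
  (forall e f, int_vectors e -> int_vectors f -> F (e + f) = F e * F f) ->
  exists q, forall e, int_vectors e -> F e = expi (2 * pi * dotp e q).
Proof.
move=> FU FM.
have /choice[q qE] : forall i, exists q, F (delta_mx i 0) = expi (2 * pi * q).
  by move=> i; apply/unit_expi/FU/int_vectors_delta.
exists (\col_i q i) => e.
have FN f : int_vectors f -> F f != 0.
  by move=> Zf; rewrite -normr_eq0 FU// oner_eq0.
elim/int_vectors_gen => [|x y Zx Zy Hx Hy|i].
- have Z0 : int_vectors (0 : 'cV[R]_n.+1).
    by rewrite -(subrr (delta_mx 0 0)); apply: int_vectorsB; exact: int_vectors_delta.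
  rewrite dot0p mulr0 expi0; apply: (mulfI (FN _ Z0)).
  by rewrite -FM// addr0 mulr1.
- apply: (mulIf (FN _ Zy)); rewrite -FM//; last exact: int_vectorsB.
  by rewrite subrK Hx Hy -expiD -mulrDr -dotpDl subrK.
- by rewrite dotp_delta mxE.
Qed.

Lemma character_space (R : realType) n (h : 'cV[R]_n.+1 -> R[i]) :
  (forall x, `|h x| = 1) -> (forall x y, h (x + y) = h x * h y) ->
  (forall a, a < 1 -> \forall x \near (0 : 'cV[R]_n.+1), a < complex.Re (h x)) ->
  exists r, forall x, h x = expi (2 * pi * dotp x r).
Proof.
move=> hU hD hC.
have h0 : h 0 = 1.
  have nz : h 0 != 0 by rewrite -normr_eq0 hU oner_eq0.
  by apply: (mulfI nz); rewrite -hD addr0 mulr1.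
have /choice[r rE] : forall i, exists c, forall t : R,
    h (t *: delta_mx i 0) = expi (2 * pi * (t * c)).
  move=> i; apply: character_line => [t|t u|a a1]; first exact: hU.
    by rewrite scalerDl hD.
  have cv : (t *: (delta_mx i 0 : 'cV[R]_n.+1)) @[t --> 0] --> (0 : 'cV[R]_n.+1).
    by rewrite -[X in _ --> X](scale0r (delta_mx i 0)); exact: scalel_continuous.
  exact: cv _ (hC _ a1).
exists (\col_i r i) => x.
have -> : x = \sum_i x i 0 *: delta_mx i 0.
  by rewrite {1}(matrix_sum_delta x); apply: eq_bigr => i _; rewrite big_ord1.
rewrite (big_morph h hD h0) [dotp _ _]dotpC dotp_sumr mulr_sumr.
rewrite (big_morph _ expiD expi0); apply: eq_bigr => i _; rewrite rE.
congr (expi (_ * _)); rewrite dotpC -[RHS]/(dotp _ _) /dotp (bigD1 i)//= big1.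
  by rewrite addr0 !mxE !eqxx mulr1.
by move=> j /negPf ji; rewrite !mxE ji mulr0 mul0r.
Qed.

(** * Powers of a rational matrix modulo an integer *)

Section IntegralPolynomials.
Context {n : nat}.
Variable M : 'M[rat]_n.+1.

Definition int_horner (a : {poly int}) : 'M[rat]_n.+1 :=
  horner_mx M (map_poly intr a).

Lemma int_hornerD : {morph int_horner : a b / a + b}.
Proof. by move=> a b; rewrite /int_horner !rmorphD. Qed.

Lemma int_hornerN : {morph int_horner : a / - a}.
Proof. by move=> a; rewrite /int_horner !rmorphN. Qed.

Lemma int_hornerM : {morph int_horner : a b / a * b}.
Proof. by move=> a b; rewrite /int_horner !rmorphM. Qed.

Lemma int_hornerX : int_horner 'X = M.
Proof. by rewrite /int_horner map_polyX horner_mx_X. Qed.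

Lemma int_hornerXn k : int_horner 'X^k = M ^+ k.
Proof. by rewrite /int_horner map_polyXn rmorphXn /= horner_mx_X. Qed.

Lemma int_horner_nat N : int_horner N%:R = N%:R.
Proof. by rewrite /int_horner !rmorph_nat. Qed.

(** Clear denominators, then the content, in the characteristic polynomial. *)
Lemma primitive_annihilator :
  exists2 f : {poly int}, zcontents f = 1 & int_horner f = 0.
Proof.
have [q [a a0 qE]] := rat_poly_scale (char_poly M).
have q0 : q != 0.
  apply/eqP => q0; move: (char_poly_monic M); rewrite qE q0 map_poly0 scaler0.
  by rewrite monicE lead_coef0 eq_sym oner_eq0.
exists (zprimitive q); first by rewrite zcontents_primitive q0.
have : int_horner q = 0.
  have := Cayley_Hamilton M; rewrite qE linearZ /= => /eqP.
  by rewrite scaler_eq0 invr_eq0 intr_eq0 (negPf a0) /= => /eqP.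
rewrite [X in int_horner X](zpolyEprim q) /int_horner map_polyZ linearZ /=.
move=> /eqP; rewrite scaler_eq0 intr_eq0 zcontents_eq0 (negPf q0) /=.
by move=> /eqP.
Qed.

Lemma primitive_coef p (f : {poly int}) : prime p -> zcontents f = 1 ->
  exists2 i, ~~ (p%:Z %| f`_i)%Z & (forall j, (j < i)%N -> (p%:Z %| f`_j)%Z).
Proof.
move=> p_pr f1.
have ex : exists i, ~~ (p%:Z %| f`_i)%Z.
  apply: contrapT => /forallNP nex.
  have : (p%:Z %| zcontents f)%Z.
    rewrite dvdz_contents; apply/polyOverP => i.
    by have /negP := nex i; rewrite negbK.
  by rewrite f1 dvdz1 => /eqP p1; rewrite /= in p1; rewrite p1 in p_pr.
case: (ex_minnP ex) => i ip imin; exists i => // j ji.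
by apply: contraLR ji => /imin; rewrite leqNgt.
Qed.

(** In the ring [Z[M]], [M ^ c] is a multiple of [N] modulo arbitrarily high
    powers of [M]: a uniform form of the splitting of a finite
    [Z[M] / N]-module into a part where [M] is nilpotent and a part where it
    is invertible. *)
Definition power_splits N c := forall k, exists a r : {poly int},
  int_horner 'X^c = int_horner (N%:R * a + 'X^(c + k) * r).

(** Modulo [p] the annihilator becomes ['X^c] times a polynomial with
    invertible constant term, which expresses [M ^ c] as a multiple of
    [M ^ c.+1]; iterate. *)
Lemma power_splits_prime p : prime p -> exists c, power_splits p c.
Proof.
move=> p_pr; have [f f1 fM] := primitive_annihilator.
have [c fc fmin] := primitive_coef p_pr f1; exists c.
have [h hE] : exists h, take_poly c f = p%:Z *: h.
  apply/polyOver_dvdzP/polyOverP => j; rewrite coef_take_poly.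
  by case: ifP => [/fmin //|_]; rewrite dvdz0.
pose g := drop_poly c f; pose g' := drop_poly 1 g.
have gE : g = g' * 'X + (f`_c)%:P.
  rewrite -[LHS](poly_take_drop 1) addrC; congr (_ + _).
  apply/polyP => j; rewrite coef_take_poly coefC.
  by case: j => [|j] //=; rewrite coef_drop_poly.
have [u [v uv]] := Bezoutz p%:Z f`_c.
have {uv} uv : u * p%:Z + v * f`_c = 1.
  rewrite uv /gcdz; congr Posz; apply/eqP; rewrite -/(coprime _ _) absz_nat.
  by rewrite prime_coprime.
have fE : f = p%:Z *: h + (g' * 'X + (f`_c)%:P) * 'X^c.
  by rewrite -gE -hE poly_take_drop.
(* The coefficient of index [c] is the first one prime to [p]: invert it
   modulo [p] with the Bezout relation [uv] to solve the annihilator for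
   ['X^c]. *)
have XcE : 'X^c = v%:P * f + p%:R * (u%:P * 'X^c - v%:P * h)
    + 'X^(c.+1) * (- (v%:P * g')) :> {poly int}.
  have pC : (p%:Z)%:P = p%:R :> {poly int} by rewrite -polyC_natr -natz.
  have uvP : u%:P * p%:R + v%:P * (f`_c)%:P = 1 :> {poly int}.
    by rewrite -pC -!polyCM -polyCD uv.
  rewrite -[LHS]mul1r -[X in X * _]uvP [X in v%:P * X + _]fE -mul_polyC pC exprS.
  ring.
have step : int_horner 'X^c = int_horner
    (p%:R * (u%:P * 'X^c - v%:P * h) + 'X^(c.+1) * (- (v%:P * g'))).
  rewrite {1}XcE -addrA int_hornerD [int_horner (_ * f)]int_hornerM fM mulr0.
  by rewrite add0r.
move: (u%:P * 'X^c - v%:P * h) (- (v%:P * g')) step => a r step {XcE}.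
elim=> [|k [ak [rk IH]]].
  by exists 0, 1; rewrite addn0 mulr0 add0r mulr1.
exists (ak + 'X^k * a * rk), (r * rk).
rewrite IH int_hornerD exprD -mulrA [int_horner ('X^c * _)]int_hornerM step.
rewrite -int_hornerM -int_hornerD.
by congr int_horner; rewrite addnS -addSn exprD; ring.
Qed.

(** The two defects [x] and [x'] vanish at [M], and the required relation
    holds modulo the ideal that they generate. *)
Lemma power_splitsM N N' c c' :
  power_splits N c -> power_splits N' c' -> power_splits (N * N') (c + c').
Proof.
move=> Nc Nc' k; have [a [r ar]] := Nc k; have [a' [r' ar']] := Nc' k.
exists (a * a'), (r' + r - 'X^k * r * r').
set x := 'X^c - (N%:R * a + 'X^(c + k) * r).
set x' := 'X^c' - (N'%:R * a' + 'X^(c' + k) * r').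
have x0 : int_horner x = 0 by rewrite int_hornerD int_hornerN ar subrr.
have x'0 : int_horner x' = 0 by rewrite int_hornerD int_hornerN ar' subrr.
have -> : 'X^(c + c') = (N * N')%:R * (a * a') +
    'X^(c + c' + k) * (r' + r - 'X^k * r * r') +
    (x * (N'%:R * a') + x' * ('X^c - 'X^(c + k) * r)).
  by rewrite /x /x' natrM !exprD; ring.
rewrite int_hornerD -[RHS]addr0; congr (_ + _).
by rewrite int_hornerD !int_hornerM x0 x'0 !mul0r addr0.
Qed.

Lemma power_splits_ex N : (0 < N)%N -> exists c, power_splits N c.
Proof.
elim/ltn_ind: N => N IH N0.
have [N1|N1] := leqP N 1.
  have -> : N = 1%N by apply/eqP; rewrite eqn_leq N1.
  exists 0%N => k; exists 1, 0; congr int_horner.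
  by rewrite mulr0 mulr1 addr0 expr0.
have [c Hc] := power_splits_prime (pdiv_prime N1).
have lt : (N %/ pdiv N < N)%N by rewrite ltn_Pdiv// prime_gt1// pdiv_prime.
have [|c' Hc'] := IH _ lt; first by rewrite divn_gt0 ?pdiv_gt0// pdiv_leq.
by exists (c' + c)%N; rewrite -(divnK (pdiv_dvd N)); exact: power_splitsM.
Qed.

End IntegralPolynomials.

(** * The balls of [L(M)] *)

Section AdicBalls.
Context {R : realType} {n : nat}.
Variable D : adic_system R n.
Local Notation L := (adic_lat D : set 'cV[R]_n.+1).
Local Notation M := (adic_mat D).
Implicit Types (k j : int) (x y : 'cV[R]_n.+1).

Lemma ratmulXK k x : ratmul (M ^ - k) (ratmul (M ^ k) x) = x.
Proof. by rewrite ratmulXzD addNr expr0z ratmul1. Qed.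

Lemma lattice_adic_ball0 x : L x -> adic_ball L M 0 x.
Proof.
move=> Lx; exists x; last by rewrite expr0z ratmul1.
apply/lbracketP; exists 1%N, (fun=> x); split=> //.
by rewrite big_ord1 expr0 ratmul1.
Qed.

Lemma lbracketE x : lbracket L M x <-> adic_ball L M 0 x.
Proof.
split=> [Lx|[y Ly <-]]; last by rewrite expr0z ratmul1.
by exists x => //; rewrite expr0z ratmul1.
Qed.

Lemma adic_ball_lparen k x : adic_ball L M k x -> lparen L M x.
Proof. by move=> xk; apply/lparenP; exists k. Qed.

Lemma adic_ballXE k j x :
  adic_ball L M (j + k) (ratmul (M ^ j) x) <-> adic_ball L M k x.
Proof.
split=> [/(adic_ballX (- j))|]; last exact: adic_ballX.
by rewrite addKr ratmulXK.
Qed.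

Lemma adic_ball_sum k I (r : seq I) (P : pred I) (F : I -> 'cV[R]_n.+1) :
  (forall i, P i -> adic_ball L M k (F i)) ->
  adic_ball L M k (\sum_(i <- r | P i) F i).
Proof.
by move=> HF; elim/big_rec: _ => [|i x Pi xk]; [exact: adic_ball0|
  apply: adic_ballD => //; exact: HF].
Qed.

Lemma adic_ballMz k x (m : int) : adic_ball L M k x -> adic_ball L M k (x *~ m).
Proof.
move=> xk; have H (i : nat) : adic_ball L M k (x *+ i).
  by elim: i => [|i IH]; [exact: adic_ball0|rewrite mulrS; exact: adic_ballD].
case: m => i; first exact: H.
by rewrite NegzE mulrNz -pmulrn; apply: adic_ballN; exact: H.
Qed.

Lemma adic_ball_int_horner k (a : {poly int}) x :
  adic_ball L M k x -> adic_ball L M k (ratmul (int_horner M a) x).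
Proof.
elim/poly_ind: a x => [|a c IH] x xk.
  have -> : int_horner M 0 = 0%:R by exact: (int_horner_nat M 0).
  by rewrite ratmul_nat mulr0n; exact: adic_ball0.
rewrite int_hornerD int_hornerM int_hornerX ratmulDl -ratmulM.
apply: adic_ballD.
  apply: IH; apply: (@adic_ball_le _ _ _ k (1 + k)); first by lia.
  by rewrite -[X in ratmul X](expr1z M); exact: adic_ballX.
have -> : int_horner M c%:P = 1 *~ c.
  rewrite /int_horner map_polyC /= horner_mx_C.
  exact: (rmorph_int (@scalar_mx rat n.+1)).
by rewrite ratmulMz ratmul1; exact: adic_ballMz.
Qed.

Lemma lparen_int_horner (a : {poly int}) x :
  lparen L M x -> lparen L M (ratmul (int_horner M a) x).
Proof.
by move=> /lparenP[k /(adic_ball_int_horner a) ?]; apply/lparenP; exists k.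
Qed.

Lemma power_splits_act N c : power_splits M N c -> forall (k : nat) x,
  exists a r : {poly int}, ratmul (M ^ c%:Z) x =
    ratmul (int_horner M a) x *+ N +
    ratmul (M ^ (c + k)%N%:Z) (ratmul (int_horner M r) x).
Proof.
move=> Nc k x; have [a [r ar]] := Nc k; exists a, r.
rewrite -ratmul_nat !ratmulM -ratmulDl; congr ratmul.
by rewrite -!exprnP -!int_hornerXn ar int_hornerD !int_hornerM int_horner_nat.
Qed.

(** Apply [M ^ c = N a(M) + M ^ (c + l) r(M)] to [x]: the first term is
    [a(M) (N x)], and the second one is as small as required when [l] is
    large. The loss [c] does not depend on [x]. *)
Lemma adic_ball_torsion N c k x : power_splits M N c -> lparen L M x ->
  adic_ball L M (k + c%:Z) (x *+ N) -> adic_ball L M k x.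
Proof.
move=> Nc /lparenP[j xj] xN.
have [a [r E]] := power_splits_act Nc `|k - j|%N x.
apply/(@adic_ballXE _ c%:Z); rewrite E [c%:Z + k]addrC; apply: adic_ballD.
  by rewrite -ratmulMn; exact: adic_ball_int_horner.
apply: (@adic_ball_le _ _ _ _ ((c + `|k - j|)%N%:Z + j)); first by lia.
by apply: adic_ballX; exact: adic_ball_int_horner.
Qed.

(** In [x = M ^ - c (N a(M) x) + M ^ l (r(M) x)], the first term is a multiple
    of [N] in [L(M)] and the second one is small for large [l]. *)
Lemma lparen_dense_multiples N c k x : power_splits M N c -> lparen L M x ->
  exists2 y, lparen L M y & adic_ball L M k (x - y *+ N).
Proof.
move=> Nc Lx; have [j xj] := (lparenP _ _).1 Lx.
have [a [r E]] := power_splits_act Nc `|k - j|%N x.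
exists (ratmul (M ^ - c%:Z) (ratmul (int_horner M a) x)).
  by apply: lparenX; exact: lparen_int_horner.
rewrite -ratmulMn -[X in X - _](ratmulXK c%:Z) E -ratmulB addrAC subrr add0r.
rewrite ratmulXzD; apply: (@adic_ball_le _ _ _ _ (- c%:Z + (c + `|k - j|)%N%:Z + j)).
  by lia.
by apply: adic_ballX; exact: adic_ball_int_horner.
Qed.

Lemma lparen_gen (P : 'cV[R]_n.+1 -> Prop) : P 0 ->
  (forall x y, lparen L M x -> lparen L M y -> P x -> P y -> P (x + y)) ->
  (forall i x, L x -> P (ratmul (M ^ i) x)) ->
  forall x, lparen L M x -> P x.
Proof.
move=> P0 PD PL x [k _ [l Ll <-]].
have LM i y : L y -> lparen L M (ratmul (M ^ i) y).
  by move=> /lattice_adic_ball0 /adic_ball_lparen; exact: lparenX.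
suff [] : lparen L M (\sum_(i < k.*2.+1) ratmul (M ^ (i%:Z - k%:Z)) (l i)) /\
  P (\sum_(i < k.*2.+1) ratmul (M ^ (i%:Z - k%:Z)) (l i)) by [].
elim/big_rec: _ => [|i y _ [Ly Py]]; first by split=> //; exact: lparen0.
split; first by apply: lparenD => //; exact/LM/Ll.
by apply: PD => //; [exact/LM/Ll|exact/PL/Ll].
Qed.

Local Notation b := (adic_base D).

Lemma nu_geP k x : lparen L M x ->
  adic_ball L M k x <-> (((k%:~R)%:E : \bar R) <= nu L M x)%E.
Proof.
move=> Lx; split=> [xk|].
  apply: le_ereal_inf_tmp => _ [j /= xj <-]; rewrite lee_fin ler_int leNgt.
  by apply/negP => jk; apply: xj; apply: adic_ball_le xk; lia.
move=> kx; apply: contrapT => xk.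
have : (nu L M x <= (((k - 1)%:~R)%:E : \bar R))%E.
  by apply: ereal_inf_lbound; exists (k - 1) => //=; rewrite subrK.
by move=> /(le_trans kx); rewrite lee_fin ler_int; lia.
Qed.

Lemma adic_abs_small k x : lparen L M x ->
  adic_abs b (nu L M x) < b%:R `^ (- k%:~R) :> R -> adic_ball L M k x.
Proof.
move=> Lx lt; apply: contrapT => xk.
have le : (nu L M x <= ((k%:~R)%:E : \bar R))%E.
  rewrite leNgt; apply/negP => kx; apply: xk; apply/nu_geP => //; exact: ltW.
by have := adic_abs_le D (nu_gtNy Lx) le; rewrite leNgt /= lt.
Qed.

Lemma adic_abs_ball k x : lparen L M x ->
  adic_ball L M k x -> adic_abs b (nu L M x) <= b%:R `^ (- k%:~R) :> R.
Proof.
move=> Lx /(nu_geP _ Lx) le.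
by apply: le_trans (adic_abs_le D _ le) _; rewrite ?ltNyr.
Qed.

Lemma adic_base_small (e : R) : 0 < e -> exists k : nat,
  b%:R `^ (- k%:Z%:~R) < e.
Proof.
move=> e0; exists (Num.truncn e^-1).+1.
have b1 := adic_base_gt1 D.
rewrite powRN -pmulrn powR_mulrn ?ler0n// -ltf_pV2 ?posrE//; last first.
  by rewrite invr_gt0 exprn_gt0// ltr0n ltnW.
rewrite invrK; apply: lt_trans (truncnS_gt _) _.
by rewrite -natrX ltr_nat ltn_expl.
Qed.

End AdicBalls.

(** * The completion of [L(M)] *)

Section AdicCompletion.
Context {R : realType} {n : nat}.
Variable D : adic_system R n.
Local Notation L := (adic_lat D : set 'cV[R]_n.+1).
Local Notation M := (adic_mat D).
Local Notation b := (adic_base D).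
Local Notation W := (adic_space D).
Implicit Types (k j : int) (x : 'cV[R]_n.+1) (u v : adic_seq D) (y z : W).

Lemma adic_seq_cauchy u k : exists m, forall i j : nat, (m <= i)%N -> (m <= j)%N ->
  adic_ball L M k (u i - u j).
Proof.
have b0 : 0 < b%:R `^ (- k%:~R) :> R.
  by rewrite powR_gt0// ltr0n ltnW// adic_base_gt1.
have [m um] := adic_seqC u b0; exists m => i j mi mj.
by apply: adic_abs_small; [apply: lparenB; exact: adic_seqP|exact: um].
Qed.

Lemma adic_nullP u : u \in @adic_null R n D <->
  forall k, \forall i \near \oo, adic_ball L M k (u i).
Proof.
split=> [/asboolP u0 k|uk]; last apply/asboolP.
  have b0 : 0 < b%:R `^ (- k%:~R) :> R.
    by rewrite powR_gt0// ltr0n ltnW// adic_base_gt1.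
  have /cvgrPdist_lt /(_ _ b0) H := u0.
  near=> i; apply: adic_abs_small; first exact: adic_seqP.
  have : `|0 - adic_dist L M b (u i) 0| < b%:R `^ (- k%:~R) by near: i.
  by rewrite /adic_dist subr0 sub0r normrN ger0_norm// adic_abs_ge0.
apply/cvgrPdist_lt => e e0; have [k ke] := adic_base_small D e0.
near=> i; rewrite /adic_dist subr0 sub0r normrN ger0_norm ?adic_abs_ge0//.
apply: le_lt_trans ke; apply: adic_abs_ball; first exact: adic_seqP.
by near: i; exact: uk.
Unshelve. all: by end_near. Qed.

Lemma adic_classB u v : adic_class (u - v) = adic_class u - adic_class v.
Proof. exact: raddfB. Qed.

Lemma adic_classD u v : adic_class (u + v) = adic_class u + adic_class v.
Proof. exact: raddfD. Qed.

(** The closure of [M ^ k L[M]] in the completion. Membership is read off a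
    representing sequence, and [adic_cball_class] shows that the choice of
    this sequence is immaterial. *)
Definition adic_cball k (y : W) : Prop :=
  \forall i \near \oo, adic_ball L M k (adic_repr y i).

Lemma adic_cball_class k u :
  adic_cball k (adic_class u) <-> \forall i \near \oo, adic_ball L M k (u i).
Proof.
have /adic_nullP /(_ k) H : adic_repr (adic_class u) - u \in @adic_null R n D.
  by apply/adic_classP; rewrite adic_reprK.
split=> Hk; near=> i.
  have -> : u i = adic_repr (adic_class u) i - (adic_repr (adic_class u) - u) i.
    by rewrite /= subKr.
  by apply: adic_ballB; near: i.
have -> : adic_repr (adic_class u) i = u i + (adic_repr (adic_class u) - u) i.
  by rewrite /= addrC subrK.
by apply: adic_ballD; near: i.
Unshelve. all: by end_near. Qed.

Lemma adic_cball0 k : adic_cball k 0.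
Proof.
have -> : 0 = adic_class (0 : adic_seq D) by exact/esym/raddf0.
by apply/adic_cball_class; near=> i; exact: adic_ball0.
Unshelve. all: by end_near. Qed.

Lemma adic_cballB k y z : adic_cball k y -> adic_cball k z -> adic_cball k (y - z).
Proof.
move=> yk zk; rewrite -[y]adic_reprK -[z]adic_reprK -adic_classB.
apply/adic_cball_class; near=> i; apply: adic_ballB; near: i => //.
Unshelve. all: by end_near. Qed.

Lemma adic_cballN k y : adic_cball k y -> adic_cball k (- y).
Proof. by move=> ?; rewrite -sub0r; apply: adic_cballB => //; exact: adic_cball0. Qed.

Lemma adic_cballD k y z : adic_cball k y -> adic_cball k z -> adic_cball k (y + z).
Proof. by move=> ? /adic_cballN ?; rewrite -[z]opprK; exact: adic_cballB. Qed.

Lemma adic_cballMn k y (N : nat) : adic_cball k y -> adic_cball k (y *+ N).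
Proof.
by move=> yk; elim: N => [|N IH]; [exact: adic_cball0|rewrite mulrS; exact: adic_cballD].
Qed.

Lemma adic_cball_le k j y : k <= j -> adic_cball j y -> adic_cball k y.
Proof. by move=> kj; apply: filterS => i; exact: adic_ball_le. Qed.

Lemma adic_cball_total y : exists k, adic_cball k y.
Proof.
have [m um] := adic_seq_cauchy (adic_repr y) 0.
have /lparenP[k xk] := adic_seqP (adic_repr y) m.
exists (Num.min k 0); exists m => // i /= mi.
rewrite -[adic_repr y i](subrK (adic_repr y m)); apply: adic_ballD.
  by apply: adic_ball_le (um _ _ mi (leqnn m)); rewrite ge_min lexx orbT.
by apply: adic_ball_le xk; rewrite ge_min lexx.
Qed.

Lemma adic_cball_eq0 y : (forall k, adic_cball k y) -> y = 0.
Proof.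
move=> H; rewrite -[y]adic_reprK.
have -> : 0 = adic_class (0 : adic_seq D) by exact/esym/raddf0.
by apply/adic_classP; rewrite subr0; exact/adic_nullP.
Qed.

Definition adic_const x (Lx : lparen L M x) : adic_seq D :=
  AdicSeq (adic_cst_cauchy Lx).

Lemma adic_embedE x (Lx : lparen L M x) :
  adic_embed D x = adic_class (adic_const Lx).
Proof.
rewrite /adic_embed; congr adic_class; apply: val_inj => /=.
by rewrite insubdK//; exact: adic_cst_cauchy.
Qed.

Lemma adic_cball_embed k x : lparen L M x ->
  adic_cball k (adic_embed D x) <-> adic_ball L M k x.
Proof.
move=> Lx; rewrite adic_embedE; apply: iff_trans (adic_cball_class _ _) _.
split=> [[m _ /(_ m)]|xk]; first by apply; rewrite /=.
by near=> i.
Unshelve. all: by end_near. Qed.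

Lemma adic_embedB x x' : lparen L M x -> lparen L M x' ->
  adic_embed D (x - x') = adic_embed D x - adic_embed D x'.
Proof.
move=> Lx Lx'; rewrite (adic_embedE (lparenB Lx Lx')) !adic_embedE.
by rewrite -adic_classB; congr adic_class; exact: val_inj.
Qed.

Lemma adic_embed0 : adic_embed D 0 = 0.
Proof. by rewrite -[X in adic_embed D X](subrr 0) adic_embedB ?subrr//; exact: lparen0. Qed.

Lemma adic_embedD x x' : lparen L M x -> lparen L M x' ->
  adic_embed D (x + x') = adic_embed D x + adic_embed D x'.
Proof.
move=> Lx Lx'; rewrite -[x' in LHS]opprK adic_embedB//; last exact: lparenN.
by rewrite -sub0r adic_embedB ?adic_embed0 ?sub0r ?opprK//; exact: lparen0.
Qed.

Lemma lparenMn x N : lparen L M x -> lparen L M (x *+ N).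
Proof.
by move=> Lx; elim: N => [|N IH]; [exact: lparen0|rewrite mulrS; exact: lparenD].
Qed.

Lemma adic_embedMn x N : lparen L M x -> adic_embed D (x *+ N) = adic_embed D x *+ N.
Proof.
move=> Lx; elim: N => [|N IH]; first exact: adic_embed0.
by rewrite !mulrS adic_embedD ?IH//; exact: lparenMn.
Qed.

Lemma adic_approx k y : exists2 x, lparen L M x & adic_cball k (y - adic_embed D x).
Proof.
have [m um] := adic_seq_cauchy (adic_repr y) k.
have Lx := adic_seqP (adic_repr y) m; exists (adic_repr y m) => //.
rewrite adic_embedE -[X in X - _]adic_reprK -adic_classB.
by apply/adic_cball_class; exists m => // i /= mi; exact: um.
Qed.

Lemma adic_scale_class j u :
  adic_scale j (adic_class u) = adic_class (AdicSeq (adic_scale_cauchy j u)).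
Proof.
apply/adic_classP/adic_nullP => k.
have /adic_nullP /(_ (k - j)) H : adic_repr (adic_class u) - u \in @adic_null R n D.
  by apply/adic_classP; rewrite adic_reprK.
near=> i.
suff : adic_ball L M k (ratmul (M ^ j) ((adic_repr (adic_class u) - u) i)).
  by rewrite ratmulB.
by rewrite -[k](subrKC j); apply: adic_ballX; near: i.
Unshelve. all: by end_near. Qed.

Lemma adic_scaleB j : {morph @adic_scale _ _ D j : y z / y - z}.
Proof.
move=> y z; rewrite -[y]adic_reprK -[z]adic_reprK -adic_classB !adic_scale_class.
rewrite -adic_classB; congr adic_class; apply: val_inj; apply/funext => i /=.
exact: ratmulB.
Qed.

Lemma adic_scaleD j : {morph @adic_scale _ _ D j : y z / y + z}.
Proof.
move=> y z; rewrite -[y]adic_reprK -[z]adic_reprK -adic_classD !adic_scale_class.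
rewrite -adic_classD; congr adic_class; apply: val_inj; apply/funext => i /=.
exact: ratmulD.
Qed.

Lemma adic_scaleMn j y N : adic_scale j (y *+ N) = adic_scale j y *+ N.
Proof.
elim: N => [|N IH]; last by rewrite !mulrS adic_scaleD IH.
by have := adic_scaleB j 0 0; rewrite !subrr.
Qed.

Lemma adic_scale_embed j x : lparen L M x ->
  adic_scale j (adic_embed D x) = adic_embed D (ratmul (M ^ j) x).
Proof.
move=> Lx; rewrite !adic_embedE; first exact: lparenX.
by move=> LMx; rewrite adic_scale_class; congr adic_class; exact: val_inj.
Qed.

Lemma adic_cball_scale j k y :
  adic_cball (j + k) (adic_scale j y) <-> adic_cball k y.
Proof.
rewrite -[y]adic_reprK adic_scale_class.
split=> [/adic_cball_class|/adic_cball_class] H; apply/adic_cball_class;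
  by move: H; apply: filterS => i /=; rewrite adic_ballXE.
Qed.

(** Off the intersection of all balls, a Cauchy sequence modulo the first ball
    that misses [y] has eventually constant valuation. *)
Lemma adic_nuE y : ((forall k, adic_cball k y) /\ adic_nu y = +oo%E) \/
  exists k, [/\ adic_cball k y, ~ adic_cball (k + 1) y & adic_nu y = (k%:~R)%:E].
Proof.
have [all|/existsNP[k1 nk1]] := pselect (forall k, adic_cball k y); [left|right].
  split=> //; apply/cvg_lim => //; apply/cvgeyPge => r.
  near=> i; apply: (@le_trans _ _ ((Num.ceil r)%:~R)%:E).
    by rewrite lee_fin Num.Theory.ceil_ge.
  apply/nu_geP; first exact: adic_seqP.
  by near: i; exact: all.
have [k0 yk0] := adic_cball_total y.
have ex : exists i : nat, `[< ~ adic_cball (k0 + i.+1%:Z) y >].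
  exists `|k1 - k0|%N; apply/asboolP => H; apply: nk1.
  by apply: adic_cball_le H; lia.
case: (ex_minnP ex) => i /asboolP ni imin; exists (k0 + i%:Z).
have yk : adic_cball (k0 + i%:Z) y.
  case: i {ni} imin => [|i] imin; first by rewrite addr0.
  by apply: contrapT => H; have /imin : `[< ~ adic_cball (k0 + i.+1%:Z) y >] by
    [apply/asboolP]; rewrite ltnn.
have nk : ~ adic_cball (k0 + i%:Z + 1) y by rewrite -addrA -PoszD addn1.
split=> //; apply/cvg_lim => //.
have [m um] := adic_seq_cauchy (adic_repr y) (k0 + i%:Z + 1).
apply: cvg_near_cst; near=> p; apply/eqP; rewrite eq_le; apply/andP; split.
  apply: ereal_inf_lbound; exists (k0 + i%:Z) => //= H; apply: nk.
  exists m => // q /= mq; rewrite -[adic_repr y q](subrK (adic_repr y p)).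
  apply: adic_ballD => //; apply: um => //.
  by near: p; exists m.
apply/nu_geP; first exact: adic_seqP.
by near: p.
Unshelve. all: by end_near. Qed.

Lemma adic_nu_geP k y : adic_cball k y <-> (((k%:~R)%:E : \bar R) <= adic_nu y)%E.
Proof.
have [[all ->]|[j [yj nyj ->]]] := adic_nuE y.
  by split=> // _; rewrite leey.
rewrite lee_fin ler_int; split=> [yk|kj]; last exact: adic_cball_le yj.
by rewrite leNgt; apply/negP => jk; apply: nyj; apply: adic_cball_le yk; lia.
Qed.

Lemma adic_limit a (x : nat -> 'cV[R]_n.+1) : (forall p, lparen L M (x p)) ->
  (forall p, adic_ball L M (a + p%:Z) (x p.+1 - x p)) ->
  exists y, forall p, adic_cball (a + p%:Z) (y - adic_embed D (x p)).
Proof.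
move=> Lx dx.
have step p q : (p <= q)%N -> adic_ball L M (a + p%:Z) (x q - x p).
  elim: q => [|q IH]; first by rewrite leqn0 => /eqP ->; rewrite subrr; exact: adic_ball0.
  rewrite leq_eqVlt => /orP[/eqP ->|]; first by rewrite subrr; exact: adic_ball0.
  rewrite ltnS => pq; rewrite -(subrKA (x q)); apply: adic_ballD; last exact: IH.
  by apply: adic_ball_le (dx q); lia.
have xC : x \in adic_cauchy D.
  apply/asboolP; split=> // e e0; have [k ke] := adic_base_small D e0.
  exists `|k%:Z - a|%N => i j mi mj; apply: le_lt_trans ke.
  rewrite /adic_dist; apply: adic_abs_ball; first exact: lparenB.
  wlog ij : i j mi mj / (i <= j)%N.
    move=> wl; have [ij|/ltnW ji] := leqP i j; first exact: wl.
    by rewrite -opprB; apply: adic_ballN; exact: wl.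
  rewrite -opprB; apply: adic_ballN; apply: adic_ball_le (step _ _ ij); lia.
exists (adic_class (AdicSeq xC)) => p; rewrite adic_embedE -adic_classB.
by apply/adic_cball_class; exists p => // q /= pq; exact: step.
Qed.

Lemma adic_mdistE y z : mdist y z = adic_space_dist y z.
Proof. by []. Qed.

Lemma adic_cball_nbhs k y : \forall z \near y, adic_cball k (z - y).
Proof.
have b0 : 0 < b%:R `^ (- k%:~R) :> R.
  by rewrite powR_gt0// ltr0n ltnW// adic_base_gt1.
apply/nbhs_ballP; exists (b%:R `^ (- k%:~R)) => //= z.
rewrite ballEmdist /= adic_mdistE => lt.
rewrite -[z]adic_reprK -[X in _ - X]adic_reprK -adic_classB.
apply/adic_cball_class.
have /cvgr_lt /(_ _ lt) := @adic_dist_cvg _ _ D (adic_repr y) (adic_repr z).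
apply: filterS => i /adic_abs_small H /=; rewrite -opprB; apply: adic_ballN.
by apply: H; apply: lparenB; exact: adic_seqP.
Qed.

Lemma adic_nbhsP y (U : set W) : nbhs y U ->
  exists k : int, forall z, adic_cball k (z - y) -> U z.
Proof.
move=> /nbhs_ballP[e /= e0 eU]; have e20 : 0 < e / 2 by rewrite divr_gt0.
have [k ke] := adic_base_small D e20; exists k => z zk; apply: eU.
rewrite ballEmdist /= adic_mdistE.
apply: (@le_lt_trans _ _ (e / 2)); last by rewrite ltr_pdivrMr// ltr_pMr// ltr1n.
apply: limr_le; first exact: adic_dist_cvg.
have : adic_cball k (adic_class (adic_repr y - adic_repr z)).
  by rewrite adic_classB !adic_reprK -opprB; exact: adic_cballN.
move=> /adic_cball_class; apply: filterS => i H; apply: le_trans (ltW ke).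
apply: adic_abs_ball => //; exact: (adic_seqP (adic_repr y - adic_repr z)).
Qed.

(** Approximate [y] by an element of [L(M)] modulo a ball which multiplication
    by [N] preserves. *)
Lemma adic_cball_torsion N c k y : power_splits M N c ->
  adic_cball (k + c%:Z) (y *+ N) -> adic_cball k y.
Proof.
move=> Nc yN; have [x Lx xk] := adic_approx (k + c%:Z) y.
have : adic_cball (k + c%:Z) (adic_embed D (x *+ N)).
  rewrite adic_embedMn// -[_ *+ N](subKr (y *+ N)) -mulrnBl.
  by apply: adic_cballB => //; exact: adic_cballMn.
move=> /adic_cball_embed - /(_ (lparenMn N Lx)) /(adic_ball_torsion Nc Lx) H.
rewrite -[y](subrK (adic_embed D x)); apply: adic_cballD.
  by apply: adic_cball_le xk; lia.
exact/adic_cball_embed.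
Qed.

End AdicCompletion.

(** * Digit expansions and fractional parts *)

(** Sums over half-infinite sets of integers become ordinary sums over any
    interval containing the support. *)
Lemma fsum_int_interval (V : nmodType) (S : set int) (F : int -> V) (a : int) (p : nat) :
  (forall j, S j -> F j != 0 -> a <= j < a + p%:Z) ->
  (forall j, a <= j < a + p%:Z -> ~ S j -> F j = 0) ->
  \sum_(j \in S) F j = \sum_(i < p) F (a + i%:Z).
Proof.
move=> SI IS; pose I := [set j : int | a <= j < a + p%:Z].
have -> : \sum_(j \in S) F j = \sum_(j \in S `|` I) F j.
  by apply: fsbig_widen => [j ?|j [[//|jI] nSj]]; [left|exact: IS].
have <- : \sum_(j \in I) F j = \sum_(j \in S `|` I) F j.
  apply: fsbig_widen => [j ?|j [[Sj|//] nIj]]; first by right.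
  by apply/eqP; apply: contraT => /(SI _ Sj).
have -> : I = (fun i : nat => a + i%:Z) @` `I_p.
  apply/seteqP; split=> [j /= jI|_ [i /= ip <-]]; last by rewrite /I/=; lia.
  by move: jI; rewrite /I /= => jI; exists `|j - a|%N; rewrite /=; lia.
rewrite fsbig_image; last by move=> i j _ _ /addrI [].
by rewrite -(fsbig_ord _ p (fun i : nat => F (a + i%:Z))).
Qed.

Section AdicDigits.
Context {R : realType} {n : nat}.
Variable D : adic_system R n.
Local Notation L := (adic_lat D : set 'cV[R]_n.+1).
Local Notation M := (adic_mat D).
Local Notation W := (adic_space D).
Variable E : set 'cV[R]_n.+1.
Hypothesis hE : residue_system L M E.
Implicit Types (k j : int) (y z : W) (w : int -> 'cV[R]_n.+1).

Let EL e : E e -> L e. Proof. by case: hE => + _ _; apply. Qed.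
Let E0 : E 0. Proof. by case: hE. Qed.

Lemma digit_lparen j x : L x -> lparen L M (ratmul (M ^ j) x).
Proof. by move=> /lattice_adic_ball0 /adic_ball_lparen; exact: lparenX. Qed.

(** The starting point of a digit sum may be moved down to any [a], which puts
    the sums attached to several points on a common range. *)
Lemma adic_sumE w v a p : ((a%:~R)%:E <= v)%E ->
  (forall j, ((j%:~R)%:E < v)%E -> w j = 0) ->
  adic_sum D w v (a + p%:Z) = \sum_(i < p) ratmul (M ^ (a + i%:Z)) (w (a + i%:Z)).
Proof.
move=> av w0; apply: fsum_int_interval => j /=.
  move=> [vj ->] _; rewrite andbT -(ler_int R) -lee_fin.
  exact: le_trans av vj.
move=> /andP[aj jap] nS; rewrite w0 ?ratmul0// ltNge; apply/negP => vj.
exact: nS.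
Qed.

Lemma digit_step k y : adic_cball k y ->
  exists e, E e /\ adic_cball (k + 1) (y - adic_embed D (ratmul (M ^ k) e)).
Proof.
move=> yk; have [x Lx xk] := adic_approx (k + 1) y.
have [l Ll lx] : adic_ball L M k x.
  apply/(adic_cball_embed _ Lx); rewrite -[adic_embed D x](subKr y).
  by apply: adic_cballB => //; apply: adic_cball_le xk; lia.
have [_ _ /(_ _ Ll) [e [[Ee le] _]]] := hE; exists e; split=> //.
have LMe := digit_lparen k (EL Ee).
rewrite -[y](subrK (adic_embed D x)) -addrA -adic_embedB//.
apply: adic_cballD => //; apply/adic_cball_embed; first exact: lparenB.
by rewrite -lx -ratmulB; exact: adic_ballX.
Qed.

Definition next_digit k y : 'cV[R]_n.+1 := xget 0
  [set e | E e /\ adic_cball (k + 1) (y - adic_embed D (ratmul (M ^ k) e))].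

Lemma next_digitP k y : adic_cball k y -> E (next_digit k y) /\
  adic_cball (k + 1) (y - adic_embed D (ratmul (M ^ k) (next_digit k y))).
Proof. by move=> /digit_step; exact: xgetPex. Qed.

Fixpoint digit_rest k y (i : nat) : W := if i is i'.+1 then
  let z := digit_rest k y i' in
  z - adic_embed D (ratmul (M ^ (k + i'%:Z)) (next_digit (k + i'%:Z) z)) else y.

Lemma digit_restP k y i : adic_cball k y -> adic_cball (k + i%:Z) (digit_rest k y i).
Proof.
move=> yk; elim: i => [|i IH]; first by rewrite addr0.
by have [_] := next_digitP IH; rewrite -addrA -PoszD addn1.
Qed.

(** Remove digits one at a time from the valuation of [y] on; the remainders
    tend to zero. The zero point has no first digit and is treated apart. *)
Lemma adic_expansion_ex y : exists w, adic_expansion E y w.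
Proof.
have [[all nuy]|[k [yk _ nuy]]] := adic_nuE y.
  exists (fun=> 0); split=> //; rewrite (adic_cball_eq0 all).
  have -> : (fun m : nat => adic_embed D (adic_sum D (fun=> 0) (adic_nu (0 : W)) m))
      = cst 0.
    apply/funext => m; rewrite /adic_sum fsbig1 ?adic_embed0// => i _.
    exact: ratmul0.
  exact: cvg_cst.
pose w j := if j < k then 0 else next_digit j (digit_rest k y `|j - k|%N).
have Ew j : E (w j).
  rewrite /w; case: ltP => // kj; apply: (proj1 (next_digitP _)).
  have {1}-> : j = k + `|j - k|%N%:Z by lia.
  exact: digit_restP.
have w0 j : (((j%:~R)%:E : \bar R) < adic_nu y)%E -> w j = 0.
  by rewrite nuy lte_fin ltr_int /w => ->.
exists w; split=> //.
have ky : (((k%:~R)%:E : \bar R) <= adic_nu y)%E by rewrite nuy.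
have rest p : y - adic_embed D (adic_sum D w (adic_nu y) (k + p%:Z)) = digit_rest k y p.
  rewrite adic_sumE//; elim: p => [|p IH]; first by rewrite big_ord0 adic_embed0 subr0.
  have LM i : lparen L M (ratmul (M ^ (k + i%:Z)) (w (k + i%:Z))).
    by apply: digit_lparen; exact: EL.
  have Lsum : lparen L M (\sum_(i < p) ratmul (M ^ (k + i%:Z)) (w (k + i%:Z))).
    by elim/big_rec: _ => [|i x _]; [exact: lparen0|exact: lparenD].
  rewrite big_ord_recr /= adic_embedD// opprD addrA IH /w.
  have -> : (k + p%:Z < k) = false by lia.
  by rewrite (_ : `|(k + p%:Z - k)%R|%N = p)//; lia.
move=> U /adic_nbhsP[j jU]; exists (`|k| + `|j|)%N => // m /= km.
apply: jU; have -> : m%:Z = k + `|m%:Z - k|%N%:Z by lia.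
rewrite -opprB rest; apply: adic_cballN.
by apply: adic_cball_le (digit_restP _ yk); lia.
Qed.

Lemma adic_digitsP y : adic_expansion E y (adic_digits E y).
Proof. exact: (xgetPex (fun=> 0) (adic_expansion_ex y)). Qed.

Lemma adic_digits_mem y j : E (adic_digits E y j).
Proof.
have [Ew w0 _] := adic_digitsP y.
by have [/w0 ->//|] := ltP (((j%:~R)%:E : \bar R))%E (adic_nu y); exact: Ew.
Qed.

Lemma adic_digits_lattice y j : L (adic_digits E y j).
Proof. exact/EL/adic_digits_mem. Qed.

Definition adic_trunc y j : 'cV[R]_n.+1 :=
  adic_sum D (adic_digits E y) (adic_nu y) j.

Lemma adic_truncE y a p : adic_cball a y -> adic_trunc y (a + p%:Z) =
  \sum_(i < p) ratmul (M ^ (a + i%:Z)) (adic_digits E y (a + i%:Z)).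
Proof.
by move=> /adic_nu_geP ya; apply: adic_sumE => //; have [] := adic_digitsP y.
Qed.

(** The point [y] is within the ball [j] of a long partial sum, and the terms
    of that sum of index at least [j] lie in this ball. *)
Lemma adic_trunc_cball y j : adic_cball j (y - adic_embed D (adic_trunc y j)).
Proof.
have [k yk] := adic_cball_total y; pose a := Num.min k j.
have ya : adic_cball a y by apply: adic_cball_le yk; rewrite /a; lia.
have LM i : lparen L M (ratmul (M ^ (a + i%:Z)) (adic_digits E y (a + i%:Z))).
  by apply: digit_lparen; exact: adic_digits_lattice.
have Lsum p : lparen L M (adic_trunc y (a + p%:Z)).
  by rewrite adic_truncE//; elim/big_rec: _ => [|i x _]; [exact: lparen0|exact: lparenD].
have [_ _ cv] := adic_digitsP y.
have [m _ /(_ (maxn m `|j|%N)) H] : \forall m \near \oo, adic_cball j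
    (adic_embed D (adic_trunc y m%:Z) - y) := cv _ (adic_cball_nbhs j y).
have {H} := H (leq_maxl _ _); set m' := maxn _ _ => H.
rewrite -[X in X - _](subKr (adic_embed D (adic_trunc y m'%:Z))) addrAC.
apply: adic_cballB => //.
have jE : j = a + `|j - a|%N%:Z by rewrite /a; lia.
have mE : m'%:Z = a + (`|j - a| + `|m'%:Z - j|)%N%:Z.
  by have := leq_maxr m `|j|%N; rewrite -/m' /a; lia.
rewrite {2}jE mE -adic_embedB//; apply/adic_cball_embed; first exact: lparenB.
rewrite !adic_truncE// big_split_ord /= addrAC subrr add0r.
apply: adic_ball_sum => i _.
apply: (@adic_ball_le _ _ _ _ (a + (`|j - a| + i)%N%:Z + 0)); first by lia.
by apply: adic_ballX; apply: lattice_adic_ball0; exact: adic_digits_lattice.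
Qed.

End AdicDigits.

Section AdicFractions.
Context {R : realType} {n : nat}.
Variable D : adic_system R n.
Local Notation L := (adic_lat D : set 'cV[R]_n.+1).
Local Notation M := (adic_mat D).
Local Notation W := (adic_space D).
Implicit Types (k j : int) (y z : W) (x : 'cV[R]_n.+1).

Lemma adic_mat_unitV : M^-1 \is a GRing.unit.
Proof. by rewrite unitrV; exact: adic_mat_unit. Qed.

(** Exchanging [M] and [M^-1] turns the closure properties of [L[M]] into
    those of [L[M^-1]]. *)
Definition adic_inverse : adic_system R n :=
  AdicSystem (adic_lat D) adic_mat_unitV (adic_base_gt1 D).

Lemma lbracketV0 : lbracket L M^-1 0.
Proof. exact: (lbracket0 adic_inverse). Qed.

Lemma lbracketVB x x' :
  lbracket L M^-1 x -> lbracket L M^-1 x' -> lbracket L M^-1 (x - x').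
Proof. exact: (@lbracketB _ _ adic_inverse). Qed.

Lemma lbracketVD x x' :
  lbracket L M^-1 x -> lbracket L M^-1 x' -> lbracket L M^-1 (x + x').
Proof.
move=> Lx Lx'; rewrite -[x']opprK; apply: lbracketVB => //.
by rewrite -sub0r; apply: lbracketVB => //; exact: lbracketV0.
Qed.

Lemma lbracketV_mul x : lbracket L M^-1 x -> lbracket L M^-1 (ratmul M^-1 x).
Proof. exact: (@lbracket_mul _ _ adic_inverse). Qed.

Lemma lbracketV_lattice x : L x -> lbracket L M^-1 x.
Proof. by move=> /(@lattice_adic_ball0 _ _ adic_inverse) /lbracketE. Qed.

Lemma lbracketV_pow k x : k <= 0 -> L x -> lbracket L M^-1 (ratmul (M ^ k) x).
Proof.
move=> k0 Lx; have -> : k = - `|k|%N%:Z by lia.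
elim: `|k|%N => [|i IH].
  by rewrite oppr0 expr0z ratmul1; exact: lbracketV_lattice.
have -> : M ^ (- i.+1%:Z) = M^-1 * M ^ (- i%:Z).
  by rewrite -!exprnN -!exprVn exprS.
by rewrite -ratmulM; exact: lbracketV_mul.
Qed.

Lemma lbracketV_lparen x : lbracket L M^-1 x -> lparen L M x.
Proof.
move=> /(lbracketP adic_inverse)[m [l [Ll ->]]].
elim/big_rec: _ => [|i y _ Ly]; first exact: lparen0.
apply: lparenD => //; rewrite exprVn exprnN; apply: lparenX.
exact: adic_ball_lparen (@lattice_adic_ball0 _ _ D _ (Ll i)).
Qed.

Variable E : set 'cV[R]_n.+1.
Hypothesis hE : residue_system L M E.

(** Only nonpositive powers of [M] remain once the digits of index below [- k]
    are shifted by [k]. *)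
Lemma adic_trunc_lbracketV k y :
  lbracket L M^-1 (ratmul (M ^ k) (adic_trunc E y (- k))).
Proof.
have [j yj] := adic_cball_total y; pose a := Num.min j (- k).
have ya : adic_cball a y by apply: adic_cball_le yj; rewrite /a; lia.
have -> : - k = a + `|- k - a|%N%:Z by rewrite /a; lia.
rewrite adic_truncE// ratmul_sum; elim/big_rec: _ => [|i x _ Lx].
  exact: lbracketV0.
apply: lbracketVD => //; rewrite ratmulXzD; apply: lbracketV_pow.
  by have := ltn_ord i; rewrite /a; lia.
exact: adic_digits_lattice.
Qed.

Lemma adic_trunc_lparen y k : lparen L M (adic_trunc E y k).
Proof.
rewrite -[k]opprK -[X in lparen _ _ X](@ratmulXK _ _ D (- k)) opprK.
apply: lparenX; apply: lbracketV_lparen.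
by rewrite -{2}[k]opprK; exact: adic_trunc_lbracketV.
Qed.

Lemma adic_trunc_scale_cball y k :
  adic_cball 0 (adic_scale k y - adic_embed D (ratmul (M ^ k) (adic_trunc E y (- k)))).
Proof.
rewrite -adic_scale_embed; last exact: adic_trunc_lparen.
rewrite -adic_scaleB -{1}(subrr k); apply/adic_cball_scale.
exact: adic_trunc_cball.
Qed.

Lemma adic_frac_lbracketV y : lbracket L M^-1 (adic_frac E y).
Proof. by have := adic_trunc_lbracketV 0 y; rewrite expr0z ratmul1 oppr0. Qed.

Lemma adic_frac_cball y : adic_cball 0 (y - adic_embed D (adic_frac E y)).
Proof. exact: adic_trunc_cball. Qed.

Lemma adic_frac_eq0 y : adic_cball 0 y -> adic_frac E y = 0.
Proof. by move=> /(adic_truncE hE 0); rewrite big_ord0 addr0. Qed.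

(** The difference is in the unit ball of the completion and comes from
    [L(M)], hence lies in [L[M]]. *)
Lemma adic_frac_unique y x x' : lbracket L M^-1 x -> lbracket L M^-1 x' ->
  adic_cball 0 (y - adic_embed D x) -> adic_cball 0 (y - adic_embed D x') ->
  lbracket L M^-1 (x - x') /\ lbracket L M (x - x').
Proof.
move=> Lx Lx' yx yx'; split; first exact: lbracketVB.
apply/lbracketE/(adic_cball_embed 0 (lbracketV_lparen (lbracketVB Lx Lx'))).
rewrite adic_embedB; try exact: lbracketV_lparen.
by rewrite -[X in X - _](subKr y) addrAC; exact: adic_cballB.
Qed.

End AdicFractions.

Section PointsFromFractions.
Context {R : realType} {n : nat}.
Variable D : adic_system R n.
Local Notation L := (adic_lat D : set 'cV[R]_n.+1).
Local Notation M := (adic_mat D).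
Implicit Types (i : int).

(** The points [M ^ - i t_i] form a Cauchy sequence as [i] decreases, by the
    congruences; its limit [s] has [t_i] as a fractional part of [M ^ i s].
    That [t_i] is in [L[M^-1]] follows by descending induction from the
    vanishing for large [i]. *)
Lemma adic_of_fractions (k : int) (t : int -> 'cV[R]_n.+1) :
  (forall i, k <= i -> t i = 0) ->
  (forall i, L (t (i + 1) - ratmul M (t i))) ->
  (forall i, lbracket L M^-1 (t i)) /\
  exists s, forall i, adic_cball 0 (adic_scale i s - adic_embed D (t i)).
Proof.
move=> t0 tG.
have MVM : M^-1 * M = 1 by apply: mulVr; exact: (adic_mat_unit D).
have tp (p : nat) : lbracket L M^-1 (t (k - p%:Z)).
  elim: p => [|p IH]; first by rewrite subr0 t0//; exact: lbracketV0.
  have := lbracketV_mul (lbracketVB IH (lbracketV_lattice (tG (k - p.+1%:Z)))).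
  have -> : k - p.+1%:Z + 1 = k - p%:Z by lia.
  by rewrite subKr ratmulM MVM ratmul1.
have tL i : lbracket L M^-1 (t i).
  have [ki|ik] := lerP k i; first by rewrite t0//; exact: lbracketV0.
  by have -> : i = k - `|k - i|%N%:Z by lia.
split=> //.
pose x (p : nat) := ratmul (M ^ (p%:Z - k)) (t (k - p%:Z)).
have Lx p : lparen L M (x p) by apply: lparenX; exact: lbracketV_lparen.
have dx (p : nat) : adic_ball L M (- k + p%:Z) (x p.+1 - x p).
  have -> : x p.+1 - x p = - ratmul (M ^ (p%:Z - k))
      (t (k - p.+1%:Z + 1) - ratmul M (t (k - p.+1%:Z))).
    rewrite ratmulB opprB -[X in ratmul X (t (k - p.+1%:Z))](expr1z M).
    rewrite ratmulXzD; congr (ratmul (_ ^ _) _ - ratmul _ (t _)); lia.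
  apply: adic_ballN; have := adic_ballX (p%:Z - k) (lattice_adic_ball0 (tG (k - p.+1%:Z))).
  by rewrite addr0 addrC.
have [s sx] := adic_limit Lx dx; exists s => i.
have [ki|ik] := lerP k i.
  rewrite t0// adic_embed0 subr0.
  have /(adic_cball_scale i) : adic_cball (- k) s.
    have x0 : x 0%N = 0 by rewrite /x [t _]t0 ?ratmul0// subr0.
    have {1}-> : - k = - k + 0%N%:Z by lia.
    by have := sx 0%N; rewrite x0 adic_embed0 (subr0 s).
  by apply: adic_cball_le; lia.
have /(adic_cball_scale i) := sx `|k - i|%N.
rewrite adic_scaleB (adic_scale_embed _ (Lx _)) /x ratmulXzD.
have -> : i + (`|k - i|%N%:Z - k) = 0 by lia.
have -> : i + (- k + `|k - i|%N%:Z) = 0 by lia.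
have -> : k - `|k - i|%N%:Z = i by lia.
by rewrite expr0z ratmul1.
Qed.

End PointsFromFractions.

(** * Roots of characters of [L((M))] *)

Section AdicCharacters.
Context {R : realType} {n : nat}.
Variable D : adic_system R n.
Local Notation L := (adic_lat D : set 'cV[R]_n.+1).
Local Notation M := (adic_mat D).
Implicit Types (i k : int).
Variable g : adic_space D -> R[i].
Hypothesis gU : forall y, `|g y| = 1.
Hypothesis gM : forall y z, g (y + z) = g y * g z.

Lemma adic_hom0 : g 0 = 1.
Proof.
have g0 : g 0 != 0 by rewrite -normr_eq0 gU oner_eq0.
by apply: (mulfI g0); rewrite -gM addr0 mulr1.
Qed.

Lemma adic_homMn y N : g (y *+ N) = g y ^+ N.
Proof. by elim: N => [|N IH]; rewrite ?adic_hom0// mulrS gM IH exprS. Qed.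

Lemma adic_homB y z : g (y - z) = 1 -> g y = g z.
Proof. by move=> yz; rewrite -[y](subrK z) gM yz mul1r. Qed.

(** Let [psi x = g x'] for any [x'] such that [N x'] is close to [x]. Such
    [x'] exist by density of the multiples of [N], and [psi x] is well defined
    because [N x'] small forces [x'] small. *)
Lemma adic_hom_root N k : (0 < N)%N -> (forall y, adic_cball k y -> g y = 1) ->
  exists (psi : 'cV[R]_n.+1 -> R[i]) (j : int),
  [/\ forall x, lparen L M x -> `|psi x| = 1,
      forall x y, lparen L M x -> lparen L M y -> psi (x + y) = psi x * psi y,
      forall x, adic_ball L M j x -> psi x = 1 &
      forall x, lparen L M x -> g (adic_embed D x) = psi x ^+ N].
Proof.
move=> N0 gk; have [c Mc] := power_splits_ex M N0; pose j := k + c%:Z.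
pose approx x := [set x' | lparen L M x' /\ adic_ball L M j (x - x' *+ N)].
have ap x : lparen L M x -> approx x (xget 0 (approx x)).
  move=> Lx; apply: (xgetPex 0).
  by have [x' Lx' xx'] := lparen_dense_multiples j Mc Lx; exists x'.
pose psi x := g (adic_embed D (xget 0 (approx x))).
have psiE x x' : lparen L M x -> approx x x' -> psi x = g (adic_embed D x').
  move=> /ap [Lx2 xx2] [Lx' xx'].
  apply: adic_homB; rewrite -adic_embedB//; apply: gk.
  apply/(adic_cball_embed k (lparenB Lx2 Lx')).
  apply: (adic_ball_torsion Mc); first exact: lparenB.
  rewrite mulrnBl -[X in X - _](subKr x) addrAC.
  exact: adic_ballB.
have psiD x y : lparen L M x -> lparen L M y -> psi (x + y) = psi x * psi y.
  move=> Lx Ly; have [Lx' xx'] := ap _ Lx; have [Ly' yy'] := ap _ Ly.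
  rewrite -gM -adic_embedD//; apply: psiE; first exact: lparenD.
  split; first exact: lparenD.
  by rewrite mulrnDl opprD addrACA; exact: adic_ballD.
have psi0 x : adic_ball L M j x -> psi x = 1.
  move=> xj; rewrite (psiE x 0); first by rewrite adic_embed0 adic_hom0.
    exact: adic_ball_lparen xj.
  by split; [exact: lparen0|rewrite mul0rn subr0].
exists psi, j; split=> // x Lx; first exact: gU.
rewrite -(psiE (x *+ N)); first last.
- by split=> //; rewrite subrr; exact: adic_ball0.
- exact: lparenMn.
suff : forall l : nat, psi (x *+ l) = psi x ^+ l by exact.
elim=> [|l IH]; first by rewrite mulr0n psi0//; exact: adic_ball0.
by rewrite mulrS psiD//; [rewrite IH exprS|exact: lparenMn].
Qed.

End AdicCharacters.

(** * The pairing and the characters of [K_A] *)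

(** Additivity modulo [Z] transfers along congruences. *)
Lemma additive_mod_int_congr (R : realType) (p q r p' q' r' : R) :
  p - p' \is a Num.int -> q - q' \is a Num.int -> r - r' \is a Num.int ->
  p' - (q' + r') \is a Num.int -> p - (q + r) \is a Num.int.
Proof.
move=> hp hq hr h.
have -> : p - (q + r) = (p - p') + (p' - (q' + r')) - ((q - q') + (r - r')) by ring.
by rewrite rpredB// rpredD.
Qed.

Lemma additive_mod_intD (R : realType) (p q r p' q' r' : R) :
  p - (q + r) \is a Num.int -> p' - (q' + r') \is a Num.int ->
  (p + p') - ((q + q') + (r + r')) \is a Num.int.
Proof. by move=> h h'; rewrite addrACA opprD addrACA rpredD. Qed.

Section AdicDuality.
Context {R : realType} {n : nat} {A : 'M[rat]_n.+1}.
Hypothesis hA : expanding R A.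
Hypothesis hb : (2 <= adic_index (Zlattice R n) A^-1)%N.
Variables (Lambda Gamma : lattice R n).
Hypothesis hLambda : lbracket (Zlattice R n) A `&` lbracket (Zlattice R n) A^-1
  `<=` Lambda.
Hypothesis hGamma : lbracket Gamma A^T `&` lbracket Gamma (A^-1)^T
  `<=` dual_lattice Lambda.
Variables (E Estar : set 'cV[R]_n.+1).
Hypothesis hE : residue_system (Zlattice R n) A^-1 E.
Hypothesis hEstar : residue_system Gamma (A^-1)^T Estar.

Local Notation DB := (sysB hA hb).
Local Notation DS := (sysBstar hA hb Gamma).
Local Notation B := (adic_mat DB).
Local Notation Bt := (adic_mat DS).
Local Notation G := (Gamma : set 'cV[R]_n.+1).
Local Notation La := (Lambda : set 'cV[R]_n.+1).
Local Notation LB := (adic_lat DB : set 'cV[R]_n.+1).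
Local Notation LS := (adic_lat DS : set 'cV[R]_n.+1).
Local Notation pairing := (adic_pairing E Estar).
Implicit Types (y z : adic_space DB) (s t u : adic_space DS) (a i j : int).

Lemma tr_invVE : ((A^-1)^T)^-1 = A^T.
Proof. by have := tr_expz A^-1 (- 1); rewrite !exprN1 invrK. Qed.

Lemma adic_mat_tr : Bt = B^T.
Proof. by []. Qed.

Lemma dotp_ratmul_pow j (x x' : 'cV[R]_n.+1) :
  dotp (ratmul (B ^ j) x) x' = dotp x (ratmul (Bt ^ j) x').
Proof. by rewrite dotp_ratmul tr_expz adic_mat_tr. Qed.

Lemma lbracket_AVE x : lbracket (adic_lat DB) B^-1 x =
  lbracket (Zlattice R n) A x.
Proof. by rewrite /= invrK. Qed.

Lemma lbracket_AtrVE x : lbracket (adic_lat DS) Bt^-1 x = lbracket Gamma A^T x.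
Proof. by rewrite /= tr_invVE. Qed.

(** An element of [Gamma] lies in both [Gamma[A^T]] and [Gamma[B^T]]. *)
Lemma lattice_sub_dual x : G x -> dual_lattice Lambda x.
Proof.
move=> Gx; apply: hGamma; split.
  by rewrite -lbracket_AtrVE; exact: (@lbracketV_lattice _ _ DS).
exact/(lbracketE DS)/lattice_adic_ball0.
Qed.

Lemma dual_dotp_int x x' : La x -> dual_lattice Lambda x' ->
  dotp x x' \is a Num.int.
Proof. by move=> Lx [_ /(_ _ Lx) [m mE]]; rewrite dotpC mE intr_int. Qed.

(** Modulo [Z], any fractional part can replace the one given by the
    digits. *)
Lemma frac_dotp y x g : lbracket (Zlattice R n) A x ->
  adic_cball 0 (y - adic_embed DB x) -> G g ->
  dotp (adic_frac E y) g - dotp x g \is a Num.int.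
Proof.
move=> Lx yx Gg; rewrite -dotpBl; apply: dual_dotp_int; last exact: lattice_sub_dual.
apply: hLambda; rewrite /setI /= -lbracket_AVE.
apply: (@adic_frac_unique _ _ DB y) => //.
- exact: (@adic_frac_lbracketV _ _ DB).
- by rewrite lbracket_AVE.
- exact: (@adic_frac_cball _ _ DB).
Qed.

(** The digit of [s] vanishes to the left of the interval, the fractional part
    of [B ^ j y] to its right. *)
Lemma pairingE s y a p : adic_cball a s -> adic_cball (- (a + p%:Z)) y ->
  pairing s y = \sum_(i < p)
    dotp (adic_frac E (adic_scale (a + i%:Z) y)) (adic_digits Estar s (a + i%:Z)).
Proof.
move=> /adic_nu_geP sa yp; apply: fsum_int_interval => j /=.
  move=> sj ne0; rewrite -(ler_int R) -lee_fin (le_trans sa sj) /= ltNge.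
  apply/negP => le; move/eqP: ne0; apply; rewrite adic_frac_eq0 ?dot0p//.
  rewrite -(subrr j); apply/adic_cball_scale.
  by apply: adic_cball_le yp; rewrite lerN2.
move=> _ nS; have [_ w0 _] := adic_digitsP (D := DS) hEstar s.
by rewrite w0 ?dotp0// ltNge; apply/negP.
Qed.

Lemma pairing_eq0 s y a : adic_cball a s -> adic_cball (- a) y -> pairing s y = 0.
Proof.
by move=> sa ya; rewrite (@pairingE s y a 0) ?big_ord0// addr0.
Qed.

Lemma pairingDr s y z :
  pairing s (y + z) - (pairing s y + pairing s z) \is a Num.int.
Proof.
have [a sa] := adic_cball_total s.
have [k yk] := adic_cball_total y; have [l zl] := adic_cball_total z.
pose p := `|- a - Num.min k l|%N.
have yp : adic_cball (- (a + p%:Z)) y by apply: adic_cball_le yk; rewrite /p; lia.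
have zp : adic_cball (- (a + p%:Z)) z by apply: adic_cball_le zl; rewrite /p; lia.
rewrite !(pairingE sa (p := p))//; last exact: adic_cballD.
rewrite -big_split -sumrB /=; apply: rpred_sum => i _.
rewrite -dotpDl; apply: frac_dotp.
- rewrite -lbracket_AVE.
  by apply: (@lbracketVD _ _ DB); exact: (@adic_frac_lbracketV _ _ DB).
- rewrite adic_embedD; try by
    apply: lbracketV_lparen; exact: (@adic_frac_lbracketV _ _ DB).
  rewrite adic_scaleD opprD addrACA; apply: adic_cballD;
    exact: (@adic_frac_cball _ _ DB).
- exact: (@adic_digits_lattice _ _ DS).
Qed.

(** For [j < - i] the vector [B ^ (i + j) e] is its own fractional part.
    Moving the powers of [B] across the scalar product leaves [e] against the
    shifted beginning of the expansion of [s], which is a fractional part of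
    [B^T ^ i s]. *)
Lemma pairing_pow s i e x : int_vectors e -> lbracket Gamma A^T x ->
  adic_cball 0 (adic_scale i s - adic_embed DS x) ->
  pairing s (adic_embed DB (ratmul (B ^ i) e)) - dotp e x \is a Num.int.
Proof.
move=> Ze Gx sx.
have [k sk] := adic_cball_total s; pose a := Num.min k (- i).
have sa : adic_cball a s by apply: adic_cball_le sk; rewrite /a; lia.
pose p := `|- i - a|%N; have pE : a + p%:Z = - i by rewrite /p /a; lia.
have LBe j : lparen (adic_lat DB) B (ratmul (B ^ j) e).
  by apply: (@digit_lparen _ _ DB).
have yp : adic_cball (- (a + p%:Z)) (adic_embed DB (ratmul (B ^ i) e)).
  rewrite pE opprK; apply/(adic_cball_embed i (LBe i)).
  have := adic_ballX i (@lattice_adic_ball0 _ _ DB _ Ze).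
  by rewrite addr0.
(* The fractional part of [B^T ^ i s] read on the digits of [s]; any other one
   differs from it by an element of the dual of [Lambda], hence by an integer
   vector. *)
pose x' := ratmul (Bt ^ i) (adic_trunc (D := DS) Estar s (- i)).
have x'x : dotp e (x' - x) \is a Num.int.
  apply: dotp_int => //.
  suff [] : dual_lattice Lambda (x' - x) by [].
  apply: hGamma; rewrite /setI /= -lbracket_AtrVE.
  apply: (@adic_frac_unique _ _ DS (adic_scale i s)) => //.
  - exact: (@adic_trunc_lbracketV _ _ DS).
  - by rewrite lbracket_AtrVE.
  - exact: (@adic_trunc_scale_cball _ _ DS).
rewrite -(subrKA (dotp e x')) -dotpBr rpredD//.
rewrite (pairingE sa yp) /x' -pE (adic_truncE (D := DS) hEstar)// ratmul_sum.
rewrite dotp_sumr -sumrB; apply: rpred_sum => l _.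
rewrite (@ratmulXzD _ _ DS) -dotp_ratmul_pow; apply: frac_dotp.
- rewrite -lbracket_AVE; apply: (@lbracketV_pow _ _ DB) => //.
  by have := ltn_ord l; lia.
- rewrite (adic_scale_embed _ (LBe i)) (@ratmulXzD _ _ DB) [i + _]addrC subrr.
  exact: adic_cball0.
- exact: (@adic_digits_lattice _ _ DS).
Qed.

(** By additivity in [y] it suffices to treat the generators [B ^ i e], where
    fractional parts of [B^T ^ i s] and [B^T ^ i t] add up to one of
    [B^T ^ i (s + t)]. *)
Lemma pairingDl s t y :
  pairing (s + t) y - (pairing s y + pairing t y) \is a Num.int.
Proof.
have [k sk] := adic_cball_total s; have [l tl] := adic_cball_total t.
pose a := Num.min k l.
have sa : adic_cball a s by apply: adic_cball_le sk; rewrite /a; lia.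
have ta : adic_cball a t by apply: adic_cball_le tl; rewrite /a; lia.
have sta := adic_cballD sa ta.
have [x Lx xy] := adic_approx (- a) y.
have red u : adic_cball a u ->
    pairing u y - pairing u (adic_embed DB x) \is a Num.int.
  move=> ua; have := pairingDr u (y - adic_embed DB x) (adic_embed DB x).
  by rewrite subrK (pairing_eq0 ua xy) add0r.
suff : pairing (s + t) (adic_embed DB x) -
    (pairing s (adic_embed DB x) + pairing t (adic_embed DB x)) \is a Num.int.
  exact: additive_mod_int_congr (red _ sta) (red _ sa) (red _ ta).
elim/(@lparen_gen _ _ DB): x / Lx {red xy} => [|x x' Lx Lx' Hx Hx'|i e Ze].
- rewrite (adic_embed0 DB) !(pairing_eq0 (a := a))//; try exact: adic_cball0.
  by rewrite addr0 subr0.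
- rewrite (adic_embedD Lx Lx').
  apply: (additive_mod_int_congr (pairingDr _ _ _) (pairingDr _ _ _) (pairingDr _ _ _)).
  exact: (additive_mod_intD Hx Hx').
- have key u : pairing u (adic_embed DB (ratmul (B ^ i) e)) -
      dotp e (adic_frac Estar (adic_scale i u)) \is a Num.int.
    apply: pairing_pow => //.
      by rewrite -lbracket_AtrVE; exact: (@adic_frac_lbracketV _ _ DS).
    exact: (@adic_frac_cball _ _ DS).
  have key' : pairing (s + t) (adic_embed DB (ratmul (B ^ i) e)) -
      dotp e (adic_frac Estar (adic_scale i s) + adic_frac Estar (adic_scale i t))
      \is a Num.int.
    apply: pairing_pow => //.
      by rewrite -lbracket_AtrVE; apply: (@lbracketVD _ _ DS); exact: (@adic_frac_lbracketV _ _ DS).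
    rewrite adic_embedD; try by
      apply: lbracketV_lparen; exact: (@adic_frac_lbracketV _ _ DS).
    rewrite adic_scaleD opprD addrACA; apply: adic_cballD;
      exact: (@adic_frac_cball _ _ DS).
  by apply: (additive_mod_int_congr key' (key s) (key t)); rewrite dotpDr subrr.
Qed.

Definition adic_character s y : R[i] := expi (2 * pi * pairing s y).

Lemma expi_congr (r r' : R) : r - r' \is a Num.int ->
  expi (2 * pi * r) = expi (2 * pi * r').
Proof.
move=> /intrP[m rr']; rewrite -[r](subrK r') rr' mulrDr expiD expi_int mul1r.
by [].
Qed.

Lemma adic_characterDr s y z :
  adic_character s (y + z) = adic_character s y * adic_character s z.
Proof. by rewrite -expiD -mulrDr; apply: expi_congr; exact: pairingDr. Qed.

Lemma adic_characterDl s t y :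
  adic_character (s + t) y = adic_character s y * adic_character t y.
Proof. by rewrite -expiD -mulrDr; apply: expi_congr; exact: pairingDl. Qed.

Lemma adic_character_eq1 s y a : adic_cball a s -> adic_cball (- a) y ->
  adic_character s y = 1.
Proof. by move=> sa ya; rewrite /adic_character (pairing_eq0 sa ya) mulr0 expi0. Qed.

Lemma adic_character_pow s i e x : int_vectors e -> lbracket Gamma A^T x ->
  adic_cball 0 (adic_scale i s - adic_embed DS x) ->
  adic_character s (adic_embed DB (ratmul (B ^ i) e)) = expi (2 * pi * dotp e x).
Proof. by move=> Ze Gx sx; apply: expi_congr; exact: pairing_pow. Qed.


Lemma Gamma_index : exists2 m, (0 < m)%N &
  forall x : 'cV[R]_n.+1, int_vectors x -> G (x *+ m).
Proof.
apply: int_lattice_index; first exact: lattice_full.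
by move=> x /(lattice_sub_dual) [].
Qed.

(** All fractional parts of the [B^T ^ i s] are integral, so their multiples
    by the index [m] of [Gamma] lie in [Gamma]. Thus [m s] lies in all balls,
    and [s] as well, up to the bounded loss due to [m]. *)
Lemma adic_character_inj s : (forall y, adic_character s y = 1) -> s = 0.
Proof.
move=> s1; apply: adic_cball_eq0 => k.
have [m m0 Gm] := Gamma_index.
have [c Bc] := power_splits_ex Bt m0.
apply: (adic_cball_torsion Bc); pose i : int := - (k + c%:Z).
have -> : k + c%:Z = - i + 0 by rewrite /i; lia.
pose t := adic_frac Estar (adic_scale i s).
have Gt : lbracket Gamma A^T t.
  by rewrite -(lbracket_AtrVE); exact: (@adic_frac_lbracketV _ _ DS).
have st := @adic_frac_cball _ _ DS _ hEstar (adic_scale i s).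
have Zt : int_vectors t.
  apply: int_vectors_dotp => e Ze; apply/intrP; apply: expi_eq1.
  by rewrite -(adic_character_pow Ze Gt st).
have Lt := lbracketV_lparen (@adic_frac_lbracketV _ _ DS _ hEstar (adic_scale i s)).
apply/(adic_cball_scale i); rewrite (addNKr i 0) (adic_scaleMn i s m).
rewrite -[adic_scale i s](subrK (adic_embed DS t)) mulrnDl.
apply: adic_cballD; first exact: adic_cballMn.
rewrite -adic_embedMn//; apply/(adic_cball_embed 0 (lparenMn m Lt)).
exact/lattice_adic_ball0/Gm.
Qed.


(** The vectors [q_i] with [psi (B ^ i e) = expi (2 pi <e, q_i>)] are such
    that [d (q_(i+1) - B^T q_i)] is integral, since [d B] is integral and
    [B ^ i (B (d e)) = B ^ (i + 1) (d e)]; multiplication by [m] then leads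
    into [Gamma]. *)
Lemma fractions_of_root (psi : 'cV[R]_n.+1 -> R[i]) (k : int) (m d : nat) :
  (forall x, lparen LB B x -> `|psi x| = 1) ->
  (forall x x', lparen LB B x -> lparen LB B x' -> psi (x + x') = psi x * psi x') ->
  (forall x, adic_ball LB B k x -> psi x = 1) ->
  (forall x : 'cV[R]_n.+1, int_vectors x -> G (x *+ m)) ->
  (forall x : 'cV[R]_n.+1, int_vectors x -> int_vectors (ratmul B (x *+ d))) ->
  exists t : int -> 'cV[R]_n.+1, [/\ forall i, k <= i -> t i = 0,
    forall i, LS (t (i + 1) - ratmul Bt (t i)) &
    forall i e, int_vectors e ->
      psi (ratmul (B ^ i) e) ^+ (d * m) = expi (2 * pi * dotp e (t i))].
Proof.
move=> psiU psiD psik Gm Zd.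
have LBe i e : int_vectors e -> lparen LB B (ratmul (B ^ i) e).
  by move=> Ze; exact: digit_lparen.
have /choice[q0 q0E] : forall i, exists q, forall e, int_vectors e ->
    psi (ratmul (B ^ i) e) = expi (2 * pi * dotp e q).
  move=> i; apply: int_vectors_character => [e Ze|e f Ze Zf].
    exact/psiU/LBe.
  by rewrite ratmulD psiD//; exact: LBe.
(* [q0 i] is only determined modulo [Z^n]; choosing [0] where [psi] is trivial
   makes the sequence vanish for large [i]. *)
pose q i := if k <= i then 0 else q0 i.
have qE i e : int_vectors e -> psi (ratmul (B ^ i) e) = expi (2 * pi * dotp e (q i)).
  move=> Ze; rewrite /q; case: ifP => ki; last exact: q0E.
  rewrite dotp0 mulr0 expi0; apply: psik; apply: (adic_ball_le ki).
  by have := adic_ballX i (@lattice_adic_ball0 _ _ DB _ Ze); rewrite addr0.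
exists (fun i => q i *+ (d * m)); split=> [i ki|i|i e Ze].
- by rewrite /q ki mul0rn.
- rewrite ratmulMn -mulrnBl mulrnA; apply: Gm; apply: int_vectors_dotp => e Ze.
  have Zed : int_vectors (e *+ d).
    apply/int_vectorsP => l; rewrite mulmxnE rpredMn//.
    by move/int_vectorsP: Ze; exact.
  have -> : dotp e ((q (i + 1) - ratmul Bt (q i)) *+ d) =
      dotp (e *+ d) (q (i + 1)) - dotp (ratmul B (e *+ d)) (q i).
    rewrite dotp_ratmul -(adic_mat_tr) -dotpBr.
    by rewrite dotpMnr [RHS]dotpC dotpMnr dotpC.
  apply/intrP; apply: expi_eq1; rewrite mulrBr expiD expiN -!qE//; last exact: Zd.
  have -> : ratmul (B ^ i) (ratmul B (e *+ d)) = ratmul (B ^ (i + 1)) (e *+ d).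
    by rewrite -(ratmulXzD DB) expr1z.
  by rewrite mulfV// -normr_eq0 psiU ?oner_eq0//; exact: LBe.
- rewrite qE// -expiMn dotpMnr; congr expi; exact/esym/mulrnAr.
Qed.

(** Take an [N]-th root [psi] of the character, with [N = d m] as in
    [fractions_of_root]. The point [s] with the fractional parts [t_i] has a
    character equal to [psi ^ N] on the generators [B ^ i e], and characters
    are determined there by continuity. *)
Lemma adic_character_surj (g : adic_space DB -> R[i]) k :
  (forall y, `|g y| = 1) -> (forall y z, g (y + z) = g y * g z) ->
  (forall y, adic_cball k y -> g y = 1) ->
  exists s, forall y, g y = adic_character s y.
Proof.
move=> gU gM gk; have [m m0 Gm] := Gamma_index.
have [d d0 Zd] := common_denominator R B.
have dm0 : (0 < d * m)%N by rewrite muln_gt0 d0.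
have [psi [j [psiU psiD psij gpsi]]] := adic_hom_root gU gM dm0 gk.
have [t [t0 tG tE]] := fractions_of_root psiU psiD psij Gm Zd.
have [Lt [s st]] := @adic_of_fractions _ _ DS j t t0 tG.
exists s.
have cM := adic_characterDr s.
have gen x : lparen LB B x -> g (adic_embed DB x) = adic_character s (adic_embed DB x).
  elim/(@lparen_gen _ _ DB) => [|x1 x2 Lx1 Lx2 H1 H2|i e Ze].
  - rewrite adic_embed0 (adic_hom0 gU gM).
    have [a sa] := adic_cball_total s.
    by rewrite (adic_character_eq1 sa (adic_cball0 _ _)).
  - by rewrite adic_embedD// gM H1 H2 cM.
  - rewrite gpsi; last exact: digit_lparen.
    rewrite tE//; apply/esym/(adic_character_pow Ze _ (st i)).
    by rewrite -(lbracket_AtrVE).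
have [a sa] := adic_cball_total s.
move=> y; have [x Lx yx] := adic_approx (Num.max k (- a)) y.
rewrite -[y](subrK (adic_embed DB x)) gM cM gen// gk; last first.
  by apply: adic_cball_le yx; rewrite le_max lexx.
have ya : adic_cball (- a) (y - adic_embed DB x).
  by apply: adic_cball_le yx; rewrite le_max lexx orbT.
by rewrite (adic_character_eq1 sa ya).
Qed.

Local Notation K := (K_A hA hb).
Local Notation chi := (@chi_char R n A hA hb Gamma E Estar).

Lemma adic_character_local (s : adic_space DS) (y z : adic_space DB) a :
  adic_cball a s -> adic_cball (- a) (z - y) -> adic_character s z = adic_character s y.
Proof.
move=> sa yz; rewrite -[z](subrK y) (adic_characterDr).
by rewrite (adic_character_eq1 sa yz) mul1r.
Qed.

Lemma chi_charE rs (xy : K) :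
  chi rs xy = expi (2 * pi * dotp xy.1 rs.1) * adic_character rs.2 xy.2.
Proof. by []. Qed.

Lemma chi_charDr rs (u v : K) : chi rs (u + v) = chi rs u * chi rs v.
Proof.
rewrite !chi_charE (adic_characterDr rs.2 u.2 v.2).
by rewrite (dotpDl u.1 v.1 rs.1) mulrDr expiD mulrACA.
Qed.

Lemma chi_charDl (rs rs' : adic_product DS) : chi (rs + rs') = chi rs \* chi rs'.
Proof.
apply/funext => u; rewrite /= !chi_charE.
rewrite (adic_characterDl rs.2 rs'.2 u.2).
by rewrite (dotpDr u.1 rs.1 rs'.1) mulrDr expiD mulrACA.
Qed.

Lemma chi_char_norm rs (u : K) : `|chi rs u| = 1.
Proof. by rewrite chi_charE normrM !norm_expi mulr1. Qed.

Lemma dotp_continuous (r : 'cV[R]_n.+1) : continuous (fun x => dotp x r).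
Proof.
rewrite /dotp; apply: continuous_big => [|i _ x]; first exact: add_continuous.
exact: (cvgM (@coord_continuous _ _ _ i 0 x) (cvg_cst _)).
Qed.

Lemma chi_char_continuous rs : continuous (chi rs : K -> R[i]^o).
Proof.
move=> u; have [a sa] := adic_cball_total rs.2.
have cv : (expi (2 * pi * dotp v.1 rs.1) * adic_character rs.2 u.2 : R[i]^o)
    @[v --> u] --> (chi rs u : R[i]^o).
  rewrite chi_charE; apply: cvgM; last exact: cvg_cst.
  have c1 : {for u, continuous (fun v : K => 2 * pi * dotp v.1 rs.1)}.
    apply: cvgM; first exact: cvg_cst.
    apply: (@continuous_comp _ _ _ fst (fun x => dotp x rs.1)); first exact: cvg_fst.
    exact: dotp_continuous.
  exact: (continuous_comp c1 (@expi_continuous R _)).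
apply: cvg_trans cv; apply: near_eq_cvg.
have : \forall v \near u, adic_cball (- a) (v.2 - u.2).
  have : (v.2 @[v --> u] --> u.2) by exact: cvg_snd.
  by move=> /(_ _ (adic_cball_nbhs (- a) u.2)).
apply: filterS => v va; rewrite chi_charE.
by rewrite (adic_character_local sa va).
Qed.

Lemma chi_char_is_character rs : is_character (chi rs : K -> R[i]).
Proof.
split.
- move=> u; exact: (chi_char_norm rs u).
- move=> u v; exact: (chi_charDr rs u v).
- exact: (@chi_char_continuous rs).
Qed.

(** On [R^n], a nonzero coordinate of [r] would give the value [-1] at a
    suitable multiple of a basis vector. *)
Lemma chi_char_eq1 rs : (forall u : K, chi rs u = 1) -> rs = 0.
Proof.
move=> rs1; case: rs rs1 => r s rs1.
have s0 : s = 0.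
  apply: adic_character_inj => y.
  by rewrite -(rs1 (0, y)) chi_charE dot0p mulr0 expi0 mul1r.
have r0 : r = 0.
  apply/matrixP => i j; rewrite ord1 mxE; apply/eqP; apply: contraT => ri.
  have := rs1 ((2 * r i 0)^-1 *: delta_mx i 0, 0); rewrite chi_charE /=.
  have -> : adic_character s (0 : adic_space DB) = 1.
    have [a sa] := adic_cball_total s.
    exact: (adic_character_eq1 sa (adic_cball0 _ _)).
  have -> : dotp ((2 * r i 0)^-1 *: delta_mx i 0) r = 2^-1.
    rewrite /dotp (bigD1 i)//= big1 => [|l /negPf li].
      by rewrite !mxE !eqxx mulr1 addr0 invfM mulfVK.
    by rewrite !mxE li mulr0 mul0r.
  rewrite mulr1 expi_half => /eqP; rewrite eq_sym -subr_eq0 opprK.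
  by rewrite (_ : 1 + 1 = 2%:R)// pnatr_eq0.
by rewrite r0 s0.
Qed.

(** Restrict the character to both factors. The second restriction maps some
    ball, which is a subgroup, into [Re z > 1/2], so it is trivial there. *)
Lemma character_chi (f : K -> R[i]) : is_character f -> exists rs, f = chi rs.
Proof.
move=> [fU fD fC].
have f0 : f 0 = 1.
  have nz : f 0 != 0 by rewrite -normr_eq0 fU oner_eq0.
  by apply: (mulfI nz); rewrite -fD addr0 mulr1.
have near0 (a : R) : a < 1 -> \forall u \near (0 : K), a < complex.Re (f u).
  by move=> a1; apply: (continuous_Re fC); rewrite f0.
have [r rE] : exists r, forall x, f (x, 0) = expi (2 * pi * dotp x r).
  apply: character_space => [x|x y|a a1]; first exact: fU.
    by rewrite -fD; congr f; congr pair; rewrite /= addr0.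
  have [[P Q] /= [P0 Q0] PQ] := near0 _ a1.
  by apply: filterS P0 => x Px; apply: (PQ (x, 0)); split=> //; exact: nbhs_singleton Q0.
pose g (y : adic_space DB) := f (0, y).
have gU y : `|g y| = 1 by exact: fU.
have gM y z : g (y + z) = g y * g z.
  by rewrite /g -fD; congr f; congr pair; rewrite /= addr0.
have [k gk] : exists k, forall y, adic_cball k y -> g y = 1.
  have lt : 2^-1 < 1 :> R by rewrite invf_lt1// ltr1n.
  have [[P Q] /= [P0 /adic_nbhsP[k kQ]] PQ] := near0 _ lt.
  exists k => y yk; apply: no_small_subgroup => // l.
  rewrite -(adic_homMn gU gM); apply: (PQ (0, y *+ l)).
  split; first exact: nbhs_singleton P0.
  apply: kQ; rewrite subr0.
  exact: adic_cballMn.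
have [s sE] := adic_character_surj gU gM gk.
exists (r, s); apply/funext => -[x y]; rewrite chi_charE -rE -sE /g -fD.
by congr f; congr pair; rewrite /= ?addr0 ?add0r.
Qed.

End AdicDuality.

Theorem proposition4p13 (R : realType) (n : nat) (A : 'M[rat]_n.+1)
    (hA : expanding R A)
    (hb : (2 <= adic_index (Zlattice R n) A^-1)%N)
    (Lambda Gamma : lattice R n)
    (hLambda : lbracket (Zlattice R n) A `&` lbracket (Zlattice R n) A^-1
                 `<=` Lambda)
    (hGamma : lbracket Gamma A^T `&` lbracket Gamma (A^-1)^T
                `<=` dual_lattice Lambda)
    (hdual : dual_lattice Lambda `<=` Zlattice R n)
    (E Estar : set 'cV[R]_n.+1)
    (hE : residue_system (Zlattice R n) A^-1 E)
    (hEstar : residue_system Gamma (A^-1)^T Estar) :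
  let chi := @chi_char R n A hA hb Gamma E Estar in
  [/\ forall f : K_A hA hb -> R[i],
        is_character f <->
        exists (r : 'cV[R]_n.+1) (s : adic_space (sysBstar hA hb Gamma)),
          f = chi (r, s),
      {morph chi : u v / u + v >-> u \* v} &
      set_bij setT (characters (K_A hA hb)) chi].
Proof.
move=> chi; split.
- move=> f; split=> [/(character_chi hLambda hGamma hE hEstar)[[r s] ->]|].
    by exists r, s.
  by move=> [r [s ->]]; exact: (chi_char_is_character hLambda hGamma hE hEstar).
- exact: (chi_charDl hLambda hGamma hE hEstar).
split.
- by move=> rs _; exact: (chi_char_is_character hLambda hGamma hE hEstar).
- move=> u v _ _ uv; apply/eqP; rewrite -subr_eq0; apply/eqP.
  apply: (chi_char_eq1 hLambda hGamma hE hEstar) => w.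
  have nz : chi v w != 0.
    by rewrite -normr_eq0 (chi_char_norm E Estar v w) oner_eq0.
  apply: (mulIf nz); rewrite mul1r -[X in _ = X w]uv.
  have := chi_charDl hLambda hGamma hE hEstar (u - v) v.
  by rewrite subrK => /(congr1 (fun F => F w)) /= <-.
- move=> f /(character_chi hLambda hGamma hE hEstar)[rs ->].
  by exists rs.
Qed.
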